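(* Let $\mathcal{A}$ be a unital operator algebra, let $\mathcal{C}$ be a C*-cover of $\mathcal{A}$, let $\mathcal{J}_{\mathcal{A}}$ be the Šilov ideal of $\mathcal{A}$ in $\mathcal{C}$, and let $\alpha$ be a unital $*$-endomorphism of $\mathcal{C}$ that leaves invariant both $\mathcal{A}$ and $\mathcal{J}_{\mathcal{A}}$. Let $\dot{\alpha}:\mathcal{C}/\mathcal{J}_{\mathcal{A}}\to\mathcal{C}/\mathcal{J}_{\mathcal{A}}$ be given by $\dot{\alpha}(X+\mathcal{J}_{\mathcal{A}})=\alpha(X)+\mathcal{J}_{\mathcal{A}}$, $X\in\mathcal{C}$. Then the relative semicrossed products $\mathcal{A}\times_{\mathcal{C},\alpha}\mathbb{Z}^+$ and $\mathcal{A}/\mathcal{J}_{\mathcal{A}}\times_{\mathcal{C}/\mathcal{J}_{\mathcal{A}},\dot{\alpha}}\mathbb{Z}^+$ are completely isometrically isomorphic.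
   Context: A C*-algebra $\mathcal{C}\supseteq\mathcal{A}$ is a C*-cover of the operator algebra $\mathcal{A}$ if $\mathcal{A}$ generates $\mathcal{C}$ as a C*-algebra. A closed two-sided ideal $\mathcal{J}\subseteq\mathcal{C}$ is a boundary ideal for $\mathcal{A}$ if the quotient map $\mathcal{C}\to\mathcal{C}/\mathcal{J}$ is completely isometric on $\mathcal{A}$. The Šilov ideal $\mathcal{J}_{\mathcal{A}}$ is the largest boundary ideal, and $\mathcal{C}/\mathcal{J}_{\mathcal{A}}=\mathrm{C}^*_{\mathrm{env}}(\mathcal{A})$. $\mathcal{A}/\mathcal{J}_{\mathcal{A}}$ denotes the (completely isometric) image of $\mathcal{A}$ under the quotient map $\mathcal{C}\to\mathcal{C}/\mathcal{J}_{\mathcal{A}}$; invariance of a set $S$ under $\alpha$ means $\alpha(S)\subseteq S$. For a C*-algebra $\mathcal{C}$ and a $*$-endomorphism $\alpha$ of $\mathcal{C}$, Peters' semicrossed product $\mathcal{C}\times_\alpha\mathbb{Z}^+$ is the universal operator algebra generated by a copy of $\mathcal{C}$ and an isometry $\mathfrak{V}$ with $C\mathfrak{V}=\mathfrak{V}\alpha(C)$ for all $C\in\mathcal{C}$. That is, it is the completion of the polynomials $\sum_{n=0}^k\mathfrak{V}^nC_n$ ($C_n\in\mathcal{C}$) in the (matrix) norms obtained as suprema of the (matrix) norms of $\sum_{n=0}^k K^n\pi(C_n)$ over all pairs $(\pi,K)$ of a unital $*$-representation $\pi$ of $\mathcal{C}$ and an isometry $K$ with $\pi(C)K=K\pi(\alpha(C))$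 for all $C\in\mathcal{C}$. If $\mathcal{C}$ is a C*-cover of $\mathcal{A}$ and $\alpha$ leaves $\mathcal{A}$ invariant, the relative semicrossed product $\mathcal{A}\times_{\mathcal{C},\alpha}\mathbb{Z}^+$ is the norm-closed subalgebra of $\mathcal{C}\times_\alpha\mathbb{Z}^+$ generated by $\mathcal{A}$ and $\mathfrak{V}$. *)

(* Defs.v *)
From HB Require Import structures.
From mathcomp Require Import all_boot all_order all_algebra ring_quotient.
From mathcomp Require Import complex lra.
From mathcomp Require Import mathcomp_extra boolp classical_sets functions.
From mathcomp Require Import reals ereal topology normedtype sequences.

Set Implicit Arguments.
Unset Strict Implicit.
Unset Printing Implicit Defensive.

Import Order.TTheory GRing.Theory Num.Theory.
Import numFieldNormedType.Exports.

Local Open Scope classical_set_scope.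
Local Open Scope ring_scope.
Local Open Scope complex_scope.

Reserved Notation "a ** b" (at level 40, left associativity).

HB.mixin Record isHilbert (R : realType) H of CompleteNormedModule R[i] H := {
  inner : H -> H -> R[i];
  innerDl : forall x y z : H, inner (x + y) z = inner x z + inner y z;
  innerZl : forall (k : R[i]) (x z : H), inner (k *: x) z = k * inner x z;
  innerC : forall x y : H, inner y x = Num.conj (inner x y);
  innerE : forall x : H, inner x x = `|x| ^+ 2
}.

#[short(type="hilbertType")]
HB.structure Definition Hilbert (R : realType) :=
  {H of CompleteNormedModule R[i] H & isHilbert R H}.

(* Unital C*-algebras, the zero algebra being allowed. The multiplication is  *)
(* a field of its own because the hierarchy of MathComp-Analysis has no join  *)
(* of normed modules with rings.                                              *)
HB.mixin Record isCStarAlgebra (R : realType) A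
    of CompleteNormedModule R[i] A := {
  cone : A;
  cmul : A -> A -> A;
  star : A -> A;
  cmulA : forall a b c : A, cmul a (cmul b c) = cmul (cmul a b) c;
  cmul1l : forall a : A, cmul cone a = a;
  cmul1r : forall a : A, cmul a cone = a;
  cmulDl : forall a b c : A, cmul (a + b) c = cmul a c + cmul b c;
  cmulDr : forall a b c : A, cmul a (b + c) = cmul a b + cmul a c;
  cmulZl : forall (k : R[i]) (a b : A), cmul (k *: a) b = k *: cmul a b;
  cmulZr : forall (k : R[i]) (a b : A), cmul a (k *: b) = k *: cmul a b;
  starK : forall a : A, star (star a) = a;
  starD : forall a b : A, star (a + b) = star a + star b;
  starZ : forall (k : R[i]) (a : A), star (k *: a) = Num.conj k *: star a;
  starM : forall a b : A, star (cmul a b) = cmul (star b) (star a);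
  cnormM : forall a b : A, `|cmul a b| <= `|a| * `|b|;
  cnorm_star : forall a : A, `|cmul (star a) a| = `|a| ^+ 2
}.

#[short(type="cstarType")]
HB.structure Definition CStarAlgebra (R : realType) :=
  {A of CompleteNormedModule R[i] A & isCStarAlgebra R A}.

Notation "a ** b" := (cmul a b) : ring_scope.

(* Norms in MathComp-Analysis take values in the scalar field R[i].           *)
Definition rnorm (R : realType) (V : normedModType R[i]) (x : V) : R :=
  complex.Re `|x|.

Section rnorm_theory.
Variables (R : realType) (V : normedModType R[i]).
Implicit Types x y : V.

Lemma rnormE x : (rnorm x)%:C = `|x|.
Proof. by rewrite /rnorm RRe_real// normr_real. Qed.

Lemma rnorm_ge0 x : 0 <= rnorm x.
Proof. by rewrite -ler0c rnormE. Qed.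

Lemma rnormD x y : rnorm (x + y) <= rnorm x + rnorm y.
Proof. by rewrite -lecR raddfD/= !rnormE ler_normD. Qed.

Lemma rnormN x : rnorm (- x) = rnorm x.
Proof. by rewrite /rnorm normrN. Qed.

Lemma rnormB x y : rnorm (x - y) = rnorm (y - x).
Proof. by rewrite /rnorm distrC. Qed.

Lemma rnorm0 : rnorm (0 : V) = 0.
Proof. by rewrite /rnorm normr0. Qed.

Lemma rnorm_eq0 x : rnorm x = 0 -> x = 0.
Proof. by move=> x0; apply/normr0_eq0; rewrite -rnormE x0. Qed.

Lemma rnormZ (k : R[i]) x : rnorm (k *: x) = complex.Re `|k| * rnorm x.
Proof.
by apply: complexI; rewrite rmorphM/= rnormE normrZ rnormE.
Qed.

Lemma rnorm_small x : (forall e : R, 0 < e -> rnorm x < e) -> x = 0.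
Proof.
move=> h; apply: rnorm_eq0; apply/eqP; rewrite eq_le rnorm_ge0 andbT leNgt.
by apply/negP => /h; rewrite ltxx.
Qed.

Lemma rball x (e : R) y : ball x e%:C y <-> rnorm (x - y) < e.
Proof. by rewrite -ball_normE /ball_/= -rnormE ltcR. Qed.

Lemma gt0_realC (e : R[i]) : 0 < e -> exists2 r : R, 0 < r & e = r%:C.
Proof.
move=> e0; exists (complex.Re e).
  by rewrite -ltcR RRe_real// ger0_real// ltW.
by rewrite RRe_real// ger0_real// ltW.
Qed.

Lemma closed_rnorm (J : set V) x : closed J ->
  (forall e : R, 0 < e -> exists2 y, J y & rnorm (x - y) < e) -> J x.
Proof.
move=> cJ h; apply: cJ => B /nbhs_ballP[e /= /gt0_realC[r r0 ->] xB].
by have [y Jy xy] := h _ r0; exists y; split=> //; apply/xB/rball.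
Qed.

End rnorm_theory.

Section complete_theory.
Variables (R : realType) (V : completeNormedModType R[i]).

Lemma geo2_gt0 k : 0 < 2^-1 ^+ k :> R.
Proof. by rewrite exprn_gt0// invr_gt0. Qed.

Lemma geo2_small (e : R) : 0 < e -> exists k, 2^-1 ^+ k < e.
Proof.
move=> e0; have h1 : `|2^-1 : R| < 1.
  by rewrite ger0_norm ?invr_ge0// invf_lt1// ltr1n.
have /cvgrPdist_lt/(_ e e0)[k _ hk] := @cvg_expr R 2^-1 h1.
by exists k; have := hk k (leqnn k); rewrite sub0r normrN ger0_norm.
Qed.

Lemma complete_geo (u : nat -> V) (M : R) :
  (forall k, rnorm (u k.+1 - u k) <= M * 2^-1 ^+ k) ->
  exists l, forall k, rnorm (l - u k) <= M * 2 * 2^-1 ^+ k.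
Proof.
move=> uM.
have M0 : 0 <= M.
  by have := le_trans (rnorm_ge0 _) (uM 0%N); rewrite expr0 mulr1.
have uD k n : rnorm (u (k + n)%N - u k) <=
    M * 2 * 2^-1 ^+ k - M * 2 * 2^-1 ^+ (k + n).
  elim: n => [|n IH]; first by rewrite addn0 subrr rnorm0 subrr.
  rewrite addnS -(subrKA (u (k + n)%N)) (le_trans (rnormD _ _))//.
  have := uM (k + n)%N; rewrite exprS; move: IH.
  set a := _ ^+ k; set b := _ ^+ (k + n); set p := rnorm _; set q := rnorm _.
  by move=> h1 h2; lra.
have uD' k n : rnorm (u (k + n)%N - u k) <= M * 2 * 2^-1 ^+ k.
  apply: le_trans (uD k n) _; rewrite gerBl; apply: mulr_ge0; first by lra.
  exact/ltW/geo2_gt0.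
have : cauchy (u @ \oo).
  apply/cauchyP => e /= /gt0_realC[r r0 ->].
  have [k hk] : exists k, 2^-1 ^+ k < r / (M * 2 + 1).
    by apply: geo2_small; rewrite divr_gt0// ltr_wpDl// mulr_ge0.
  exists (u k); exists k => // n /= /subnKC <-; apply/rball.
  rewrite rnormB (le_lt_trans (uD' _ _))//.
  rewrite ltr_pdivlMr in hk; last by rewrite ltr_wpDl// mulr_ge0.
  by apply: le_lt_trans hk; have := geo2_gt0 k; set g := _ ^+ k => g0; lra.
move=> /cauchy_cvgP /cvg_ex[l ul]; exists l => k; apply/ler_addgt0Pr => e e0.
have e0' : 0 < e%:C by rewrite ltcR.
have /cvgrPdist_lt/(_ _ e0')[N _ hN] := ul.
have := hN (k + N)%N (leq_addl _ _); rewrite -rnormE ltcR => h.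
rewrite -(subrKA (u (k + N)%N)) (le_trans (rnormD _ _))// addrC lerD ?uD'//.
exact: ltW.
Qed.

End complete_theory.

Section cstar_theory.
Variables (R : realType) (A : cstarType R).
Implicit Types a b c h u x y : A.

Lemma cmul0l a : 0 ** a = 0 :> A.
Proof. by apply: (addrI (0 ** a)); rewrite -cmulDl !addr0. Qed.

Lemma cmul0r a : a ** 0 = 0 :> A.
Proof. by apply: (addrI (a ** 0)); rewrite -cmulDr !addr0. Qed.

Lemma cmulNl a b : (- a) ** b = - (a ** b).
Proof. by rewrite -scaleN1r cmulZl scaleN1r. Qed.

Lemma cmulNr a b : a ** (- b) = - (a ** b).
Proof. by rewrite -scaleN1r cmulZr scaleN1r. Qed.

Lemma cmulBl a b c : (a - b) ** c = a ** c - b ** c.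
Proof. by rewrite cmulDl cmulNl. Qed.

Lemma cmulBr a b c : a ** (b - c) = a ** b - a ** c.
Proof. by rewrite cmulDr cmulNr. Qed.

Lemma starN a : star (- a) = - star a.
Proof. by rewrite -scaleN1r starZ rmorphN rmorph1 scaleN1r. Qed.

Lemma starB a b : star (a - b) = star a - star b.
Proof. by rewrite starD starN. Qed.

Lemma star0 : star 0 = 0 :> A.
Proof. by apply: (addrI (star 0)); rewrite -starD !addr0. Qed.

Lemma star1 : star cone = cone :> A.
Proof.
by rewrite -[LHS]cmul1r -[X in star _ ** X]starK -starM cmul1r starK.
Qed.

Lemma rnormM a b : rnorm (a ** b) <= rnorm a * rnorm b.
Proof. by rewrite -lecR rmorphM/= !rnormE cnormM. Qed.

Lemma rnorm_star2 a : rnorm (star a ** a) = rnorm a ^+ 2.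
Proof. by apply: complexI; rewrite rmorphXn/= !rnormE cnorm_star. Qed.

Lemma sqr_le_cancel (x y : R) : 0 <= y -> x ^+ 2 <= y * x -> x <= y.
Proof.
move=> y0 h; rewrite leNgt; apply/negP => yx.
have x0 : 0 < x by exact: le_lt_trans yx.
by move: h; rewrite expr2 ler_pM2r// leNgt yx.
Qed.

Lemma rnorm_star a : rnorm (star a) = rnorm a.
Proof.
suff h b : rnorm b <= rnorm (star b).
  by apply/eqP; rewrite eq_le h -{2}(starK a) h.
by apply: sqr_le_cancel; rewrite ?rnorm_ge0// -rnorm_star2 rnormM.
Qed.

Lemma rnorm1 : rnorm (cone : A) <= 1.
Proof.
apply: sqr_le_cancel => //; rewrite mul1r -rnorm_star2 cmul1r.
by rewrite rnorm_star.
Qed.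

Lemma neumann u : rnorm u <= 2^-1 ->
  exists v, (cone - u) ** v = cone /\ v ** (cone - u) = cone.
Proof.
move=> u2; pose p n := iter n (cmul u) cone.
have pS n : p n.+1 = u ** p n by [].
have pSr n : p n.+1 = p n ** u.
  elim: n => [|n IH]; first by rewrite /p/= cmul1l cmul1r.
  by rewrite pS {1}IH cmulA -pS.
have pn n : rnorm (p n) <= 2^-1 ^+ n.
  elim: n => [|n IH]; first by rewrite expr0 rnorm1.
  by rewrite pS (le_trans (rnormM _ _))// exprS ler_pM// rnorm_ge0.
pose s n := \sum_(k < n) p k.
have sS n : s n.+1 = s n + p n by rewrite /s big_ord_recr.
have [|v hv] := @complete_geo _ _ s 1.
  by move=> k; rewrite mul1r sS addrC addKr pn.
have e1 n : (cone - u) ** s n = cone - p n.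
  elim: n => [|n IH]; first by rewrite /s big_ord0 cmul0r subrr.
  by rewrite sS cmulDr IH cmulBl cmul1l -pS addrA subrK.
have e2 n : s n ** (cone - u) = cone - p n.
  elim: n => [|n IH]; first by rewrite /s big_ord0 cmul0l subrr.
  by rewrite sS cmulDl IH cmulBr cmul1r -pSr addrA subrK.
pose B := 2 * rnorm (cone - u) + 1.
have B0 : 0 < B by rewrite ltr_wpDl// mulr_ge0// rnorm_ge0.
exists v; split; apply/subr0_eq/rnorm_small => e e0.
  have /geo2_small[n hn] : 0 < e / B by exact: divr_gt0.
  rewrite (_ : _ - _ = (cone - u) ** (v - s n) - p n); last first.
    by rewrite cmulBr e1 opprB addrA (addrAC _ (p n)) addrK.
  apply: le_lt_trans (rnormD _ _) _; rewrite rnormN.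
  have h1 := le_trans (rnormM (cone - u) (v - s n))
    (ler_wpM2l (rnorm_ge0 _) (hv n)).
  rewrite ltr_pdivlMr// in hn; apply: le_lt_trans hn.
  rewrite /B; have := pn n; move: h1.
  set g := _ ^+ n; set q := rnorm (cone - u).
  by set p1 := rnorm _; set p2 := rnorm _ => h1 h2; nra.
have /geo2_small[n hn] : 0 < e / B by exact: divr_gt0.
rewrite (_ : _ - _ = (v - s n) ** (cone - u) - p n); last first.
  by rewrite cmulBl e2 opprB addrA (addrAC _ (p n)) addrK.
apply: le_lt_trans (rnormD _ _) _; rewrite rnormN.
have h1 := le_trans (rnormM (v - s n) (cone - u))
  (ler_wpM2r (rnorm_ge0 _) (hv n)).
rewrite ltr_pdivlMr// in hn; apply: le_lt_trans hn.
rewrite /B; have := pn n; move: h1; set g := _ ^+ n; set q := rnorm (cone - u).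
by set p1 := rnorm _; set p2 := rnorm _ => h1 h2; nra.
Qed.

(* For selfadjoint h and purely imaginary k, 1 + k h is invertible and its    *)
(* inverse is a contraction.                                                  *)
Lemma resolvent_contr h (k : R[i]) y : star h = h -> Num.conj k = - k ->
  (cone + k *: h) ** y = cone -> rnorm y <= 1.
Proof.
move=> sh sk Ty.
have sT : star y ** (cone - k *: h) = cone.
  by rewrite -[RHS]star1 -[in RHS]Ty starM starD starZ sh sk star1 scaleNr.
have e : 2%:R *: (star y ** y) = star y + y.
  transitivity (star y ** ((cone + k *: h) ** y) +
                (star y ** (cone - k *: h)) ** y); last first.
    by rewrite Ty sT cmul1r cmul1l.
  rewrite cmulA -cmulDl -cmulDr addrACA subrr addr0.
  by rewrite scaler_nat mulr2n cmulDr cmul1r cmulDl.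
have : rnorm (2%:R *: (star y ** y)) <= 2 * rnorm y.
  by rewrite e (le_trans (rnormD _ _))// rnorm_star mulr_natl mulr2n.
rewrite rnormZ (_ : complex.Re _ = 2); last first.
  by rewrite normr_nat -(rmorph_nat (real_complex R)).
rewrite ler_pM2l// rnorm_star2 => h1.
by apply: sqr_le_cancel; rewrite // mul1r.
Qed.

Lemma resolvent_ex h : star h = h -> exists2 d : R, 0 < d & forall n, exists y,
  [/\ rnorm y <= 1, (cone + (n%:R * d)%:C * 'i%R *: h) ** y = cone &
      y ** (cone + (n%:R * d)%:C * 'i%R *: h) = cone].
Proof.
move=> sh; pose d := (2 * (rnorm h + 1))^-1.
have d0 : 0 < d by rewrite invr_gt0 mulr_gt0// ltr_wpDl// rnorm_ge0.
have dh : d * rnorm h <= 2^-1.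
  rewrite /d invfM -mulrA ler_piMr ?invr_ge0// mulrC ler_pdivrMr ?mul1r.
    by rewrite lerDl.
  by rewrite ltr_wpDl// rnorm_ge0.
have ki (r : R) : Num.conj (r%:C * 'i%R) = - (r%:C * 'i%R).
  rewrite rmorphM/= conjCi mulrN; congr (- (_ * _)).
  by apply: CrealP; apply/complex_realP; exists r.
exists d => //; elim=> [|n [y [y1 Ty yT]]].
  by exists cone; rewrite rnorm1 mul0r rmorph0 mul0r scale0r addr0 cmul1l.
pose u := - ((d%:C * 'i%R) *: (y ** h)).
have [|v [uv vu]] := @neumann u.
  rewrite rnormN rnormZ normrM (_ : `|'i%R : R[i]| = 1) ?mulr1;
    last by rewrite normCi.
  rewrite (_ : complex.Re _ = d); last first.
    by rewrite ger0_norm// ler0c ltW.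
  apply: le_trans dh; rewrite ler_wpM2l ?(ltW d0)//.
  by rewrite (le_trans (rnormM _ _))// ler_piMl ?rnorm_ge0.
have eT : cone + ((n.+1)%:R * d)%:C * 'i%R *: h =
          (cone + (n%:R * d)%:C * 'i%R *: h) ** (cone - u).
  rewrite opprK cmulDr cmul1r cmulZr cmulA Ty cmul1l -addrA -scalerDl -mulrDl.
  by rewrite -raddfD/= -natr1 mulrDl mul1r.
have T1 : (cone + ((n.+1)%:R * d)%:C * 'i%R *: h) ** (v ** y) = cone.
  by rewrite eT -cmulA (cmulA _ v) uv cmul1l.
exists (v ** y); split => //; first exact: resolvent_contr sh (ki _) T1.
by rewrite eT -cmulA (cmulA y) yT cmul1l.
Qed.

End cstar_theory.

Record closedIdeal (R : realType) (A : cstarType R) := ClosedIdeal {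
  ideal_set :> A -> Prop;
  ideal_closed : closed (ideal_set : set A);
  ideal0 : ideal_set 0;
  idealD : forall a b, ideal_set a -> ideal_set b -> ideal_set (a + b);
  idealZ : forall (k : R[i]) a, ideal_set a -> ideal_set (k *: a);
  idealMl : forall a b, ideal_set b -> ideal_set (a ** b);
  idealMr : forall a b, ideal_set a -> ideal_set (a ** b)
}.

Section quotient.
Variables (R : realType) (A : cstarType R) (J : closedIdeal A).
Implicit Types a b c : A.

Lemma idealN a : J a -> J (- a).
Proof. by move=> Ja; rewrite -scaleN1r; exact: idealZ. Qed.

Lemma idealB a b : J a -> J b -> J (a - b).
Proof. by move=> Ja Jb; apply: idealD => //; exact: idealN. Qed.

Lemma idealBC a b : J (a - b) -> J (b - a).
Proof. by move=> /idealN; rewrite opprB. Qed.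

(* An approximate-unit argument: for h in J selfadjoint the elements y below  *)
(* are contractions, congruent to 1 modulo J, and y h is small.               *)
Lemma ideal_unit h (e : R) : J h -> star h = h -> 0 < e -> exists y,
  [/\ rnorm y <= 1, J (cone - y), J (cone - star y) & rnorm (h ** y) < e].
Proof.
move=> Jh sh e0; have [d d0 hd] := resolvent_ex sh.
pose n := (Num.truncn (2 / (e * d))).+1.
have n0 : 0 < n%:R * d by rewrite mulr_gt0// ltr0n.
have [y [y1 Ty _]] := hd n.
have ye : cone - y = ((n%:R * d)%:C * 'i%R) *: (h ** y).
  by rewrite -Ty cmulDl cmul1l cmulZl addrC addKr.
exists y; split=> //; first by rewrite ye; apply/idealZ/idealMr.
  rewrite -[X in X - _]star1 -starB ye starZ starM sh.
  exact/idealZ/idealMl.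
have : rnorm (cone - y) <= 2.
  rewrite (le_trans (rnormD _ _))// rnormN.
  by have := @rnorm1 _ A; move: y1; lra.
rewrite ye rnormZ normrM normCi mulr1 (_ : complex.Re _ = n%:R * d); last first.
  by rewrite ger0_norm// ler0c ltW.
move=> h2; rewrite -(ltr_pM2l n0); apply: le_lt_trans h2 _.
have : 2 / (e * d) < n%:R by exact: truncnS_gt.
by rewrite ltr_pdivrMr ?mulr_gt0// mulrCA [e * _]mulrC.
Qed.

Lemma ideal_star a : J a -> J (star a).
Proof.
move=> Ja; apply: closed_rnorm; first exact: ideal_closed.
move=> e e0; pose h := star a ** a.
have Jh : J h by exact: idealMl.
have sh : star h = h by rewrite /h starM starK.
have e20 : 0 < e ^+ 2 by rewrite exprn_gt0.
have [y [y1 _ Jy hy]] := ideal_unit Jh sh e20.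
exists ((cone - star y) ** star a); first exact: idealMr.
rewrite cmulBl cmul1l subKr -starM rnorm_star.
rewrite -(ltr_pXn2r (n := 2)) ?nnegrE ?rnorm_ge0 ?(ltW e0)//.
rewrite -rnorm_star2 starM -cmulA (cmulA _ a) -/h.
rewrite (le_lt_trans (rnormM _ _))// rnorm_star (le_lt_trans _ hy)//.
by rewrite ler_piMl ?rnorm_ge0.
Qed.

Definition ideal_pred : {pred A} := fun a => `[< J a >].

Lemma ideal_pred_zmod_closed : zmod_closed ideal_pred.
Proof.
split; first by apply/asboolP; exact: ideal0.
by move=> a b /asboolP Ja /asboolP Jb; apply/asboolP/idealB.
Qed.

HB.instance Definition _ := GRing.isZmodClosed.Build A ideal_pred
  ideal_pred_zmod_closed.

Definition cquot : Type := Quotient.quot ideal_pred.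
HB.instance Definition _ := GRing.Zmodule.on cquot.

Definition qproj_fun (a : A) : cquot := (\pi_(Quotient.quot ideal_pred) a)%qT.
Definition qrepr (X : cquot) : A := repr (X : Quotient.quot ideal_pred).

Lemma qreprK X : qproj_fun (qrepr X) = X.
Proof. exact: reprK. Qed.

Lemma qprojP a b : qproj_fun a = qproj_fun b <-> J (a - b).
Proof.
split=> [/eqP|Jab].
  by rewrite /qproj_fun -Quotient.idealrBE => /asboolP.
by apply/eqP; rewrite /qproj_fun -Quotient.idealrBE; apply/asboolP.
Qed.

Lemma qprojB a b : qproj_fun (a - b) = qproj_fun a - qproj_fun b.
Proof. exact: raddfB. Qed.

Lemma qprojD a b : qproj_fun (a + b) = qproj_fun a + qproj_fun b.
Proof. exact: raddfD. Qed.

Lemma qproj0 : qproj_fun 0 = 0.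
Proof. exact: raddf0. Qed.

Lemma qrepr_proj a : J (qrepr (qproj_fun a) - a).
Proof. by apply/qprojP; rewrite qreprK. Qed.

Definition qscale (k : R[i]) (X : cquot) : cquot := qproj_fun (k *: qrepr X).

Lemma qscaleE k a : qscale k (qproj_fun a) = qproj_fun (k *: a).
Proof. by apply/qprojP; rewrite -scalerBr; exact/idealZ/qrepr_proj. Qed.

Fact qscaleA k l X : qscale k (qscale l X) = qscale (k * l) X.
Proof. by rewrite -(qreprK X) !qscaleE scalerA. Qed.

Fact qscale1 : left_id 1 qscale.
Proof. by move=> X; rewrite -(qreprK X) qscaleE scale1r. Qed.

Fact qscaleDr : right_distributive qscale +%R.
Proof.
move=> k X Y; rewrite -(qreprK X) -(qreprK Y).
by rewrite -qprojD !qscaleE scalerDr qprojD.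
Qed.

Fact qscaleDl X : {morph qscale^~ X : k l / k + l}.
Proof. by move=> k l; rewrite -(qreprK X) !qscaleE scalerDl qprojD. Qed.

HB.instance Definition _ := GRing.Zmodule_isLmodule.Build R[i] cquot
  qscaleA qscale1 qscaleDr qscaleDl.

Lemma qprojZ k a : qproj_fun (k *: a) = k *: qproj_fun a.
Proof. by rewrite -qscaleE. Qed.

Definition qnormr (X : cquot) : R :=
  inf [set rnorm b | b in [set b | qproj_fun b = X]].

Lemma qnormr_lb a :
  has_inf [set rnorm b | b in [set b | qproj_fun b = qproj_fun a]].
Proof.
split; first by exists (rnorm a), a.
by exists 0 => _ [b _ <-]; exact: rnorm_ge0.
Qed.

Lemma qnormr_le a : qnormr (qproj_fun a) <= rnorm a.
Proof. by apply: ge_inf; [have [] := qnormr_lb a|exists a]. Qed.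

Lemma qnormr_ge0 X : 0 <= qnormr X.
Proof.
rewrite -(qreprK X); apply: lb_le_inf; first by have [] := qnormr_lb (qrepr X).
by move=> _ [b _ <-]; exact: rnorm_ge0.
Qed.

Lemma qnormr_lift X (e : R) : 0 < e ->
  exists2 a, qproj_fun a = X & rnorm a < qnormr X + e.
Proof.
move=> e0; rewrite -(qreprK X).
have [_ [a aX <-] h] := inf_adherent e0 (qnormr_lb (qrepr X)).
by exists a.
Qed.

Lemma qnormr_leP X (r : R) : (forall a, qproj_fun a = X -> r <= rnorm a) ->
  r <= qnormr X.
Proof.
move=> h; apply/ler_addgt0Pr => e /(qnormr_lift X)[a aX /ltW ae].
exact: le_trans (h _ aX) ae.
Qed.

Definition qnorm (X : cquot) : R[i] := (qnormr X)%:C.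

Fact qnormD X Y : qnorm (X + Y) <= qnorm X + qnorm Y.
Proof.
rewrite -raddfD/= lecR; apply/ler_addgt0Pr => e e0.
have e20 : 0 < e / 2 by rewrite divr_gt0.
have [a <- aX] := qnormr_lift X e20; have [b <- bY] := qnormr_lift Y e20.
rewrite -qprojD (le_trans (qnormr_le _))// (le_trans (rnormD _ _))//.
by move: aX bY; lra.
Qed.

Lemma qnormZ_le (k : R[i]) (r : R) X : `|k| = r%:C ->
  qnormr (k *: X) <= r * qnormr X.
Proof.
move=> kr; apply/ler_addgt0Pr => e e0.
have r0 : 0 <= r by rewrite -ler0c -kr.
pose f := e / (r + 1).
have f0 : 0 < f by rewrite divr_gt0// ltr_wpDl.
have [a <- aX] := qnormr_lift X f0.
rewrite -qprojZ (le_trans (qnormr_le _))// rnormZ kr.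
rewrite (le_trans (ler_wpM2l r0 (ltW aX)))// mulrDr lerD2l.
by rewrite /f mulrCA ler_piMr ?(ltW e0)// ler_pdivrMr ?ltr_wpDl// mul1r lerDl.
Qed.

Fact qnormZ (k : R[i]) X : qnorm (k *: X) = `|k| * qnorm X.
Proof.
have [r kr] : exists r : R, `|k| = r%:C.
  by exists (complex.Re `|k|); rewrite RRe_real// normr_real.
rewrite /qnorm kr -rmorphM/=; congr (_%:C).
apply/eqP; rewrite eq_le (qnormZ_le _ kr)/=.
have [k0|k0] := eqVneq k 0.
  by move: kr; rewrite k0 normr0 => /esym/complexI ->; rewrite mul0r qnormr_ge0.
have r0 : 0 < r by rewrite -ltcR -kr normr_gt0.
have kVr : `|k^-1| = r^-1%:C by rewrite normfV kr fmorphV.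
have := qnormZ_le (k *: X) kVr; rewrite scalerA mulVf// scale1r.
by rewrite ler_pdivlMl.
Qed.

Fact qnorm0_eq0 X : qnorm X = 0 -> X = 0.
Proof.
move=> /complexI X0; rewrite -(qreprK X) -qproj0; apply/qprojP; rewrite subr0.
apply: closed_rnorm; first exact: ideal_closed.
move=> e /(qnormr_lift X)[a aX]; rewrite X0 add0r => ae.
exists (qrepr X - a); last by rewrite subKr.
by apply/qprojP; rewrite qreprK aX.
Qed.

HB.instance Definition _ := Lmodule_isNormed.Build R[i] cquot
  qnormD qnormZ qnorm0_eq0.

Lemma rnorm_quot (X : cquot) : rnorm X = qnormr X.
Proof. by []. Qed.

Lemma rnorm_qproj a : rnorm (qproj_fun a) <= rnorm a.
Proof. exact: qnormr_le. Qed.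

Fact cquot_complete (F : set_system cquot) :
  ProperFilter F -> cauchy F -> cvg F.
Proof.
move=> FF /cauchyP cF.
have /choice[X FX] k : exists X : cquot, F (ball X (2^-1 ^+ k : R)%:C).
  by apply: cF; rewrite ltcR geo2_gt0.
have Xk k : rnorm (X k.+1 - X k) < 2 * 2^-1 ^+ k.
  have [Y [/rball h1 /rball h2]] := filter_ex (filterI (FX k) (FX k.+1)).
  rewrite -(subrKA Y) (le_lt_trans (rnormD _ _))//.
  rewrite rnormB in h1; move: h1 h2; rewrite exprS.
  have := geo2_gt0 R k; set g := _ ^+ k; set p := rnorm _; set q := rnorm _.
  by move=> h1 h2 h3; lra.
have /choice[d dP] k : exists d : A,
    qproj_fun d = X k.+1 - X k /\ rnorm d <= 3 * 2^-1 ^+ k.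
  have [d dX dn] := qnormr_lift (X k.+1 - X k) (geo2_gt0 R k).
  exists d; split=> //; apply/ltW/(lt_le_trans dn).
  have := Xk k; rewrite rnorm_quot; set g := _ ^+ k; set p := qnormr _.
  by move=> h; lra.
pose y k := qrepr (X 0%N) + \sum_(j < k) d j.
have yX k : qproj_fun (y k) = X k.
  elim: k => [|k IH]; first by rewrite /y big_ord0 addr0 qreprK.
  by rewrite /y big_ord_recr/= addrA qprojD IH (dP k).1 addrC subrK.
have [|l hl] := @complete_geo _ A y 3.
  move=> k; have -> : y k.+1 = y k + d k by rewrite /y big_ord_recr/= addrA.
  by rewrite addrC addKr (dP k).2.
apply/cvg_ex; exists (qproj_fun l); apply/cvgrPdist_lt => e /gt0_realC[r r0 ->].
have /geo2_small[k hk] : 0 < r / 7 by rewrite divr_gt0.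
apply: filterS (FX k) => Y /rball XY; rewrite -rnormE ltcR.
rewrite -(subrKA (X k)) (le_lt_trans (rnormD _ _))//.
have := le_trans (rnorm_qproj _) (hl k); rewrite qprojB yX.
rewrite ltr_pdivlMr// in hk; move: hk XY; set g := _ ^+ k.
by set p := rnorm _; set q := rnorm _ => h1 h2 h3; lra.
Qed.

HB.instance Definition _ := Uniform_isComplete.Build cquot cquot_complete.

Definition qone : cquot := qproj_fun cone.
Definition qmul (X Y : cquot) : cquot := qproj_fun (qrepr X ** qrepr Y).
Definition qstar (X : cquot) : cquot := qproj_fun (star (qrepr X)).

Lemma qmulE a b : qmul (qproj_fun a) (qproj_fun b) = qproj_fun (a ** b).
Proof.
apply/qprojP; set a' := qrepr _; set b' := qrepr _.
rewrite -(subrKA (a' ** b)) -cmulBr -cmulBl.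
by apply: idealD; [apply: idealMl|apply: idealMr]; exact: qrepr_proj.
Qed.

Lemma qstarE a : qstar (qproj_fun a) = qproj_fun (star a).
Proof. by apply/qprojP; rewrite -starB; exact/ideal_star/qrepr_proj. Qed.

Fact qmulA X Y Z : qmul X (qmul Y Z) = qmul (qmul X Y) Z.
Proof. by rewrite -(qreprK X) -(qreprK Y) -(qreprK Z) !qmulE cmulA. Qed.

Fact qmul1l X : qmul qone X = X.
Proof. by rewrite -(qreprK X) qmulE cmul1l. Qed.

Fact qmul1r X : qmul X qone = X.
Proof. by rewrite -(qreprK X) qmulE cmul1r. Qed.

Fact qmulDl X Y Z : qmul (X + Y) Z = qmul X Z + qmul Y Z.
Proof.
rewrite -(qreprK X) -(qreprK Y) -(qreprK Z).
by rewrite -qprojD !qmulE -qprojD cmulDl.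
Qed.

Fact qmulDr X Y Z : qmul X (Y + Z) = qmul X Y + qmul X Z.
Proof.
rewrite -(qreprK X) -(qreprK Y) -(qreprK Z).
by rewrite -qprojD !qmulE -qprojD cmulDr.
Qed.

Fact qmulZl k X Y : qmul (k *: X) Y = k *: qmul X Y.
Proof. by rewrite -(qreprK X) -(qreprK Y) -qprojZ !qmulE -qprojZ cmulZl. Qed.

Fact qmulZr k X Y : qmul X (k *: Y) = k *: qmul X Y.
Proof. by rewrite -(qreprK X) -(qreprK Y) -qprojZ !qmulE -qprojZ cmulZr. Qed.

Fact qstarK X : qstar (qstar X) = X.
Proof. by rewrite -(qreprK X) !qstarE starK. Qed.

Fact qstarD X Y : qstar (X + Y) = qstar X + qstar Y.
Proof. by rewrite -(qreprK X) -(qreprK Y) -qprojD !qstarE -qprojD starD. Qed.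

Fact qstarZ k X : qstar (k *: X) = Num.conj k *: qstar X.
Proof. by rewrite -(qreprK X) -qprojZ !qstarE -qprojZ starZ. Qed.

Fact qstarM X Y : qstar (qmul X Y) = qmul (qstar Y) (qstar X).
Proof. by rewrite -(qreprK X) -(qreprK Y) qmulE !qstarE qmulE starM. Qed.

Lemma qnormrM X Y : qnormr (qmul X Y) <= qnormr X * qnormr Y.
Proof.
suff h (e : R) : 0 < e -> qnormr (qmul X Y) <= (qnormr X + e) * (qnormr Y + e).
  apply/ler_addgt0Pr => e e0.
  have X0 := qnormr_ge0 X; have Y0 := qnormr_ge0 Y.
  pose s := qnormr X + qnormr Y + e + 1.
  have s0 : 0 < s by rewrite /s; lra.
  have f0 : 0 < e / s by rewrite divr_gt0.
  apply: le_trans (h _ f0) _.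
  have f1 : e / s <= 1 by rewrite ler_pdivrMr// /s; lra.
  have : e / s * s = e by rewrite divfK// gt_eqF.
  move: f0 f1; set f := e / s; rewrite /s.
  set p := qnormr X in X0 *; set q := qnormr Y in Y0 * => f0 f1 fs.
  nra.
move=> e0; have [a <- aX] := qnormr_lift X e0.
have [b <- bY] := qnormr_lift Y e0.
rewrite qmulE (le_trans (qnormr_le _))// (le_trans (rnormM _ _))//.
by rewrite ler_pM ?rnorm_ge0// ltW.
Qed.

Lemma qnormr_star X : qnormr (qstar X) <= qnormr X.
Proof.
apply: qnormr_leP => a <-.
by rewrite qstarE (le_trans (qnormr_le _))// rnorm_star.
Qed.

Lemma qnormr_cstar X : qnormr X ^+ 2 <= qnormr (qmul (qstar X) X).
Proof.
rewrite -(qreprK X); set a := qrepr X; rewrite qstarE qmulE.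
apply: qnormr_leP => b /qprojP Jb; pose j := b - star a ** a.
pose h : A := 2^-1 *: (j + star j).
have Jh : J h by apply/idealZ/idealD => //; exact: ideal_star.
have sh : star h = h.
  rewrite /h starZ starD starK addrC; congr (_ *: _).
  by rewrite rmorphV ?unitfE// rmorph_nat.
have bh : rnorm (star a ** a + h) <= rnorm b.
  have -> : star a ** a + h = 2^-1 *: (b + star b).
    have js : j + star j = b + star b - 2%:R *: (star a ** a).
      by rewrite /j starB starM starK addrACA -opprD scaler_nat mulr2n.
    rewrite /h js scalerBr scalerA mulVf ?pnatr_eq0// scale1r addrC.
    by rewrite subrK.
  rewrite rnormZ (_ : complex.Re _ = 2^-1); last first.
    by rewrite normfV normr_nat -(rmorph_nat (real_complex R)) -fmorphV.
  rewrite ler_pdivrMl// (le_trans (rnormD _ _))// rnorm_star.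
  by rewrite mulr_natl mulr2n.
apply/ler_addgt0Pr => e e0.
have [y [y1 Jy _ hy]] := ideal_unit Jh sh e0.
have ay : qproj_fun a = qproj_fun (a ** y).
  by apply/qprojP; rewrite -{1}(cmul1r a) -cmulBr; exact: idealMl.
have := qnormr_le (a ** y); rewrite -ay => h1.
have : qnormr (qproj_fun a) ^+ 2 <= rnorm (a ** y) ^+ 2.
  by rewrite lerXn2r// nnegrE ?rnorm_ge0 ?qnormr_ge0.
move=> /le_trans; apply; rewrite -rnorm_star2 starM.
have -> : star y ** star a ** (a ** y) =
    star y ** ((star a ** a + h) ** y) - star y ** (h ** y).
  by rewrite -cmulBr -cmulBl addrK !cmulA.
rewrite (le_trans (rnormD _ _))// rnormN lerD//.
  rewrite (le_trans (rnormM _ _))// rnorm_star.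
  rewrite (le_trans _ bh)// -[leRHS]mul1r ler_pM ?rnorm_ge0//.
  by rewrite (le_trans (rnormM _ _))// ler_piMr ?rnorm_ge0.
rewrite (le_trans (rnormM _ _))// rnorm_star (le_trans _ (ltW hy))//.
by rewrite ler_piMl ?rnorm_ge0.
Qed.

Fact cquot_normM X Y : `|qmul X Y| <= `|X| * `|Y|.
Proof. by rewrite -!rnormE -rmorphM/= lecR qnormrM. Qed.

Fact cquot_norm_star X : `|qmul (qstar X) X| = `|X| ^+ 2.
Proof.
rewrite -!rnormE -rmorphXn/=; congr (_%:C); apply/eqP.
rewrite eq_le qnormr_cstar andbT (le_trans (qnormrM _ _))//.
by rewrite expr2 ler_wpM2r ?qnormr_ge0// qnormr_star.
Qed.

HB.instance Definition _ := isCStarAlgebra.Build R cquot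
  qmulA qmul1l qmul1r qmulDl qmulDr qmulZl qmulZr
  qstarK qstarD qstarZ qstarM cquot_normM cquot_norm_star.

End quotient.

Record unitalStarHom (R : realType) (A B : cstarType R) := UnitalStarHom {
  star_hom :> {linear A -> B};
  star_hom1 : star_hom cone = cone;
  star_homM : forall a b, star_hom (a ** b) = star_hom a ** star_hom b;
  star_homS : forall a, star_hom (star a) = star (star_hom a)
}.

Section quotient_map.
Variables (R : realType) (A : cstarType R) (J : closedIdeal A).

Fact qproj_linear : linear (qproj_fun J).
Proof. by move=> k a b; rewrite qprojD qprojZ. Qed.

HB.instance Definition _ :=
  GRing.isLinear.Build R[i] A (cquot J) *:%R (qproj_fun J) qproj_linear.

Fact qprojM a b : qproj_fun J (a ** b) = qproj_fun J a ** qproj_fun J b.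
Proof. exact/esym/qmulE. Qed.

Fact qprojS a : qproj_fun J (star a) = star (qproj_fun J a).
Proof. exact/esym/qstarE. Qed.

Definition qproj : unitalStarHom A (cquot J) :=
  @UnitalStarHom R A (cquot J) (qproj_fun J) erefl qprojM qprojS.

Variable alpha : unitalStarHom A A.
Hypothesis alphaJ : alpha @` (J : set A) `<=` (J : set A).

Definition quot_endo_fun (X : cquot J) : cquot J := qproj (alpha (qrepr X)).

Lemma quot_endo_funE a : quot_endo_fun (qproj a) = qproj (alpha a).
Proof.
apply/qprojP; rewrite -raddfB; apply: alphaJ.
by exists (qrepr (qproj a) - a) => //; exact: qrepr_proj.
Qed.

Fact quot_endo_linear : linear quot_endo_fun.
Proof.
move=> k X Y; rewrite -(qreprK X) -(qreprK Y) -[qproj_fun J]/(qproj : _ -> _).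
by rewrite -linearP !quot_endo_funE !linearP.
Qed.

HB.instance Definition _ :=
  GRing.isLinear.Build R[i] (cquot J) (cquot J) *:%R quot_endo_fun
    quot_endo_linear.

Fact quot_endo1 : quot_endo_fun cone = cone.
Proof. by rewrite -(star_hom1 qproj) quot_endo_funE !star_hom1. Qed.

Fact quot_endoM X Y :
  quot_endo_fun (X ** Y) = quot_endo_fun X ** quot_endo_fun Y.
Proof.
rewrite -(qreprK X) -(qreprK Y) -[qproj_fun J]/(qproj : _ -> _).
by rewrite -star_homM !quot_endo_funE !star_homM.
Qed.

Fact quot_endoS X : quot_endo_fun (star X) = star (quot_endo_fun X).
Proof.
rewrite -(qreprK X) -[qproj_fun J]/(qproj : _ -> _).
by rewrite -star_homS !quot_endo_funE !star_homS.
Qed.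

Definition quot_endo : unitalStarHom (cquot J) (cquot J) :=
  @UnitalStarHom R (cquot J) (cquot J) quot_endo_fun
    quot_endo1 quot_endoM quot_endoS.

Lemma quot_endoE a : quot_endo (qproj a) = qproj (alpha a).
Proof. exact: quot_endo_funE. Qed.

End quotient_map.

Section bounded_operators.
Variables (R : realType) (H : hilbertType R).

Definition bop_pred : {pred (H -> H)} :=
  fun f => `[< linear f /\ continuous f >].

Record bop := Bop { bop_fun :> H -> H; bop_funP : bop_pred bop_fun }.

HB.instance Definition _ := [isSub for bop_fun].
HB.instance Definition _ := [Choice of bop by <:].

Lemma bop_linear (T : bop) : linear T.
Proof. by have /asboolP[] := bop_funP T. Qed.

Lemma bop_continuous (T : bop) : continuous T.
Proof. by have /asboolP[] := bop_funP T. Qed.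

Fact bop_submod : submod_closed bop_pred.
Proof.
split.
  apply/asboolP; split=> [k x y|]; last exact: cst_continuous.
  by rewrite /= scaler0 addr0.
move=> k f g /asboolP[fl fc] /asboolP[gl gc]; apply/asboolP; split=> [l x y|x].
  rewrite !fctE fl gl !scalerDr addrACA; congr (_ + _ + _).
  by rewrite !scalerA mulrC.
by apply: cvgD; [apply: cvgZr|]; [exact: fc|exact: gc].
Qed.

HB.instance Definition _ :=
  GRing.isSubmodClosed.Build R[i] (H -> H) bop_pred bop_submod.
HB.instance Definition _ := [SubChoice_isSubLmodule of bop by <:].

HB.instance Definition _ (T : bop) :=
  GRing.isLinear.Build R[i] H H *:%R T (bop_linear T).

Fact bop_idP : bop_pred id.
Proof. by apply/asboolP; split=> [//|x]; exact: cvg_id. Qed.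

Definition bop_id := Bop bop_idP.

Fact bop_compP (S T : bop) : bop_pred (S \o T).
Proof.
apply/asboolP; split=> [k x y|x]; first by rewrite /= !bop_linear.
by apply: continuous_comp; exact: bop_continuous.
Qed.

Definition bop_comp (S T : bop) := Bop (bop_compP S T).

Definition bop_exp (T : bop) n : bop := iter n (bop_comp T) bop_id.

Definition vnorm n (x : 'I_n -> H) : R := Num.sqrt (\sum_i rnorm (x i) ^+ 2).

(* The norm of an n x n matrix over B(H) acting on the Hilbert sum H^n.       *)
Definition op_mxnorm n (T : 'M[bop]_n) : \bar R :=
  ereal_sup [set (vnorm (fun i => \sum_j T i j (x j)))%:E
            | x in [set x : 'I_n -> H | vnorm x <= 1]].

End bounded_operators.

Record unitalStarRep (R : realType) (C : cstarType R) (H : hilbertType R) :=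
    UnitalStarRep {
  star_rep :> {linear C -> bop H};
  star_rep1 : star_rep cone = bop_id H;
  star_repM : forall a b,
    star_rep (a ** b) = bop_comp (star_rep a) (star_rep b);
  star_repS : forall a x y,
    inner (star_rep a x) y = inner x (star_rep (star a) y)
}.

(* The C*-norm of M_n(C), realized by the representations of C on Hilbert     *)
(* spaces (Gelfand-Naimark).                                                  *)
Definition cstar_mxnorm (R : realType) (C : cstarType R) n (M : 'M[C]_n) :
    \bar R :=
  ereal_sup [set r | exists (H : hilbertType R) (pi : unitalStarRep C H),
                       r = op_mxnorm (map_mx pi M)].

Definition completely_isometric_on (R : realType) (C D : cstarType R)
    (A : set C) (f : C -> D) : Prop :=
  forall n (M : 'M[C]_n), (forall i j, A (M i j)) ->
    cstar_mxnorm (map_mx f M) = cstar_mxnorm M.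

Section operator_algebras.
Variables (R : realType) (C : cstarType R).
Implicit Types (A B : set C) (J : closedIdeal C).

Record unital_operator_algebra A : Prop := UnitalOperatorAlgebra {
  opalg_closed : closed A;
  opalg1 : A cone;
  opalgD : forall a b, A a -> A b -> A (a + b);
  opalgZ : forall (k : R[i]) a, A a -> A (k *: a);
  opalgM : forall a b, A a -> A b -> A (a ** b)
}.

Record cstar_subalgebra B : Prop := CStarSubalgebra {
  cstarsub_closed : closed B;
  cstarsub0 : B 0;
  cstarsubD : forall a b, B a -> B b -> B (a + b);
  cstarsubZ : forall (k : R[i]) a, B a -> B (k *: a);
  cstarsubM : forall a b, B a -> B b -> B (a ** b);
  cstarsubS : forall a, B a -> B (star a)
}.

Definition cstar_cover A : Prop :=
  forall B, cstar_subalgebra B -> A `<=` B -> B = setT.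

Definition boundary_ideal A J : Prop := completely_isometric_on A (qproj J).

Definition silov_ideal A J : Prop :=
  boundary_ideal A J /\
  forall I : closedIdeal C, boundary_ideal A I -> (I : set C) `<=` (J : set C).

End operator_algebras.

(* Families of bounded operators, with pointwise operations and the supremum  *)
(* norm. Families over all covariant pairs (below) form a type too large for  *)
(* set and 'M[_]_n, hence the plain predicates and functions of two indices.  *)
Section operator_families.
Variables (R : realType) (I : Type) (H : I -> hilbertType R).

Definition opfam := forall i, bop (H i).

Definition fam_mxnorm n (M : 'I_n -> 'I_n -> opfam) : \bar R :=
  ereal_sup [set r | exists i : I, r = op_mxnorm (\matrix_(k, l) M k l i)].

Definition fam_norm (F : opfam) : \bar R := fam_mxnorm (fun _ _ : 'I_1 => F).

Definition fam_closure (S : opfam -> Prop) (F : opfam) : Prop :=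
  forall e : R, 0 < e ->
    exists2 G, S G & (fam_norm (fun i => (F i - G i)%R) <= e%:E)%E.

Record closed_subalgebra (S : opfam -> Prop) : Prop := ClosedSubalgebra {
  subalg_closed : forall F, fam_closure S F -> S F;
  subalg0 : S (fun i => 0);
  subalgD : forall F G, S F -> S G -> S (fun i => F i + G i);
  subalgZ : forall (k : R[i]) F, S F -> S (fun i => k *: F i);
  subalgM : forall F G, S F -> S G -> S (fun i => bop_comp (F i) (G i))
}.

Definition gen_closed_subalgebra (X : opfam -> Prop) (F : opfam) : Prop :=
  forall S, closed_subalgebra S -> (forall G, X G -> S G) -> S F.

End operator_families.

Section semicrossed_product.
Variables (R : realType) (C : cstarType R) (alpha : unitalStarHom C C).

Record covariantPair := CovariantPair {
  cov_space : hilbertType R;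
  cov_rep : unitalStarRep C cov_space;
  cov_iso : bop cov_space;
  cov_isoP : forall x, `|cov_iso x| = `|x|;
  cov_comm : forall c,
    bop_comp (cov_rep c) cov_iso = bop_comp cov_iso (cov_rep (alpha c))
}.

Definition covfam := opfam cov_space.

(* The canonical images in the semicrossed product of c and of the isometry.  *)
Definition sc_coef (c : C) : covfam := fun p => cov_rep p c.

Definition sc_iso : covfam := fun p => cov_iso p.

Definition sc_poly k (c : nat -> C) : covfam :=
  fun p => \sum_(n < k.+1) bop_comp (bop_exp (sc_iso p) n) (sc_coef (c n) p).

(* The completion of the polynomials in the supremum of their norms over all  *)
(* covariant pairs: the closure of their images in the product of the B(H).   *)
Definition semicrossed_product (F : covfam) : Prop :=
  fam_closure (fun G => exists k c, G = sc_poly k c) F.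

Definition relative_semicrossed_product (A : set C) (F : covfam) : Prop :=
  semicrossed_product F /\
  gen_closed_subalgebra
    (fun G => (exists2 a, A a & G = sc_coef a) \/ G = sc_iso) F.

End semicrossed_product.

Arguments semicrossed_product {R C} alpha F.
Arguments relative_semicrossed_product {R C} alpha A F.

Definition completely_isometrically_isomorphic (R : realType) (I I' : Type)
    (H : I -> hilbertType R) (H' : I' -> hilbertType R)
    (X : opfam H -> Prop) (Y : opfam H' -> Prop) : Prop :=
  exists Phi : opfam H -> opfam H',
    [/\ [/\ forall F, X F -> Y (Phi F),
            forall F G, X F -> X G -> Phi F = Phi G -> F = G &
            forall G, Y G -> exists2 F, X F & Phi F = G],
        forall F G, X F -> X G ->
          Phi (fun i => F i + G i) = (fun i => Phi F i + Phi G i),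
        forall (k : R[i]) F, X F ->
          Phi (fun i => k *: F i) = (fun i => k *: Phi F i),
        forall F G, X F -> X G ->
          Phi (fun i => bop_comp (F i) (G i)) =
          (fun i => bop_comp (Phi F i) (Phi G i)) &
        forall n (M : 'I_n -> 'I_n -> opfam H), (forall i j, X (M i j)) ->
          fam_mxnorm (fun i j => Phi (M i j)) = fam_mxnorm M].

(* Main.v *)
Require Import Defs.
From mathcomp Require Import all_boot all_order all_algebra complex lra.
From mathcomp Require Import boolp classical_sets functions.
From mathcomp Require Import reals ereal topology normedtype sequences.
From HB Require Import structures.

Set Implicit Arguments.
Unset Strict Implicit.
Unset Printing Implicit Defensive.

Import Order.TTheory GRing.Theory Num.Theory.
Import numFieldNormedType.Exports.

Local Open Scope classical_set_scope.
Local Open Scope ring_scope.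
Local Open Scope complex_scope.

(** Let q be the quotient map of C onto C/J. A covariant pair (sigma, V) of
    C/J for the quotient endomorphism yields the covariant pair (sigma o q, V)
    of C for alpha, so the families of operators indexed by the pairs of C
    restrict to families indexed by the pairs of C/J. Restriction is a
    completely contractive homomorphism that sends generators to generators;
    it is the required isomorphism, and what has to be proved is that it is
    completely isometric on the relative semicrossed product and onto.

    Consider an A-polynomial p = sum_m V^m a_m, or a matrix of such
    polynomials, and let r be the norm of its restriction. The left regular
    pair of a representation sigma of C/J (regular_pair) turns p into a lower
    triangular operator on l2(N, H) with entries sigma(q(alpha^j(a_{i-j}))),
    whose finite truncations therefore have norm at most r
    (toeplitz_le_regular). These truncations are the images under sigma o q of
    the matrices [alpha^j(a_{i-j})], which have entries in A because alpha(A)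
    is contained in A. As J is a boundary ideal, such matrices have the same
    norm in C as in C/J, so every representation of C maps them to operators
    of norm at most r (toeplitz_le_boundary).

    These bounds control p at an arbitrary covariant pair (pi, K) of C
    (wold_estimate). For a vector x write x = K^i x_i + sum_{l<i} K^l u_l with
    all u_l orthogonal to the range of K, as in the Wold decomposition. The
    covariance relation shows that, once i is at least the degree of p, the
    components of p(K) x in the same decomposition are
    w_i = sum_{j<=i} pi(alpha^j(a_{i-j})) x_j and
    z_l = sum_{j<=l} pi(alpha^j(a_{l-j})) u_j,
    that is, the truncated operators applied to the sequences (x_j) and (u_j).
    The vectors z_l are thus bounded by r directly; the vector w_i is so only
    on average over i, which is enough since p(K) x does not depend on i.

    The A-polynomials are dense in the relative semicrossed product
    (gen_poly_closure), because representations are uniformly bounded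
    (star_rep_bounded). Surjectivity holds because the range of the isometric
    restriction map is closed (restrict_closed). *)

(** * Inner product spaces *)

Section complex_parts.
Variable R : realType.
Implicit Types (r : R) (z w : R[i]).

Lemma ReD z w : complex.Re (z + w) = complex.Re z + complex.Re w.
Proof. by case: z w => a b [c d]. Qed.

Lemma ImD z w : complex.Im (z + w) = complex.Im z + complex.Im w.
Proof. by case: z w => a b [c d]. Qed.

Lemma ReN z : complex.Re (- z) = - complex.Re z.
Proof. by case: z. Qed.

Lemma Re_rM r z : complex.Re (r%:C * z) = r * complex.Re z.
Proof. by case: z => a b /=; rewrite mul0r subr0. Qed.

Lemma conjE z : Num.conj z = complex.Re z -i* complex.Im z.
Proof. by case: z. Qed.

Lemma Re_conj z : complex.Re (Num.conj z) = complex.Re z.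
Proof. by rewrite conjE. Qed.

Lemma conj_real r : Num.conj r%:C = r%:C.
Proof. by rewrite conjE /= oppr0. Qed.

Lemma Re_conjiM z : complex.Re (Num.conj 'i%C * z) = complex.Im z.
Proof. by case: z => a b; rewrite conjE /= mul0r mulN1r opprK add0r. Qed.

Lemma Re_sum (I : Type) (s : seq I) (P : pred I) (F : I -> R[i]) :
  complex.Re (\sum_(i <- s | P i) F i) = \sum_(i <- s | P i) complex.Re (F i).
Proof. by elim/big_rec2 : _ => // i y1 y2 _ <-; rewrite ReD. Qed.

End complex_parts.

Section inner_product.
Variables (R : realType) (V : lmodType R[i]) (ip : V -> V -> R[i]).

Record inner_product : Prop := InnerProduct {
  ipDl : forall x y z, ip (x + y) z = ip x z + ip y z;
  ipZl : forall (k : R[i]) x z, ip (k *: x) z = k * ip x z;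
  ipC : forall x y, ip y x = Num.conj (ip x y);
  ip_ge0 : forall x, 0 <= complex.Re (ip x x);
  ip_eq0 : forall x, complex.Re (ip x x) = 0 -> x = 0
}.

Definition ipnorm x : R := Num.sqrt (complex.Re (ip x x)).

Hypothesis ipP : inner_product.
Implicit Types x y z : V.

Lemma ipDr x y z : ip x (y + z) = ip x y + ip x z.
Proof. by rewrite (ipC ipP) (ipDl ipP) rmorphD/= -!(ipC ipP). Qed.

Lemma ipZr (k : R[i]) x y : ip x (k *: y) = Num.conj k * ip x y.
Proof. by rewrite (ipC ipP) (ipZl ipP) rmorphM/= -!(ipC ipP). Qed.

Lemma ipnorm_ge0 x : 0 <= ipnorm x.
Proof. exact: sqrtr_ge0. Qed.

Lemma sqr_ipnorm x : ipnorm x ^+ 2 = complex.Re (ip x x).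
Proof. by rewrite sqr_sqrtr// ip_ge0. Qed.

Lemma ipnorm_eq0 x : ipnorm x = 0 -> x = 0.
Proof. by move=> x0; apply: (ip_eq0 ipP); rewrite -sqr_ipnorm x0 expr0n. Qed.

Lemma sqr_ipnormD x y :
  ipnorm (x + y) ^+ 2 = ipnorm x ^+ 2 + ipnorm y ^+ 2
                        + 2 * complex.Re (ip x y).
Proof.
rewrite !sqr_ipnorm (ipDl ipP) !ipDr !ReD.
by rewrite (ipC ipP x y) Re_conj; lra.
Qed.

Lemma ipnormZ (k : R[i]) x : ipnorm (k *: x) = complex.Re `|k| * ipnorm x.
Proof.
have k0 : 0 <= complex.Re `|k| by rewrite -ler0c RRe_real// normr_real.
apply/eqP; rewrite -(@eqrXn2 _ 2) ?mulr_ge0 ?ipnorm_ge0//; apply/eqP.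
rewrite exprMn !sqr_ipnorm (ipZl ipP) ipZr mulrA -normCK -Re_rM.
congr complex.Re.
rewrite rmorphXn; congr (_ ^+ 2 * _); exact/esym/RRe_real/normr_real.
Qed.

Lemma ipnormZr (r : R) x : ipnorm (r%:C *: x) = `|r| * ipnorm x.
Proof.
rewrite ipnormZ; congr (_ * _).
by rewrite -[RHS]/(complex.Re (`|r|)%:C) normc_def /= expr0n addr0 sqrtr_sqr.
Qed.

Lemma re_ip_le x y : complex.Re (ip x y) <= ipnorm x * ipnorm y.
Proof.
have [x0|x0] := eqVneq (ipnorm x) 0.
  rewrite (ipnorm_eq0 x0) -{1}(scale0r (0 : V)) (ipZl ipP) mul0r /=.
  by rewrite mulr_ge0 ?ipnorm_ge0.
have [y0|y0] := eqVneq (ipnorm y) 0.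
  rewrite (ipnorm_eq0 y0) -{1}(scale0r (0 : V)) ipZr rmorph0 mul0r /=.
  by rewrite mulr_ge0 ?ipnorm_ge0.
have px : 0 < ipnorm x by rewrite lt0r x0 ipnorm_ge0.
have py : 0 < ipnorm y by rewrite lt0r y0 ipnorm_ge0.
have := sqr_ge0 (ipnorm ((ipnorm y)%:C *: x + (- ipnorm x)%:C *: y)).
rewrite sqr_ipnormD !ipnormZr (ipZl ipP) ipZr conj_real !Re_rM normrN.
rewrite !ger0_norm ?ipnorm_ge0//; move: px py.
set a := ipnorm x; set b := ipnorm y; set c := complex.Re _ => a0 b0 h.
have : 0 <= 2 * (a * b) * (a * b - c) by move: h; lra.
by rewrite pmulr_rge0 ?subr_ge0// !mulr_gt0.
Qed.

Lemma ipnormD x y : ipnorm (x + y) <= ipnorm x + ipnorm y.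
Proof.
rewrite -(ler_pXn2r (ltn0Sn 1)) ?nnegrE ?addr_ge0 ?ipnorm_ge0//.
rewrite sqr_ipnormD; have := re_ip_le x y.
by set a := ipnorm x; set b := ipnorm y; set c := complex.Re _; lra.
Qed.

End inner_product.

Section hilbert.
Variables (R : realType) (H : hilbertType R).
Implicit Types x y z : H.

Lemma inner_hilbert : inner_product (@inner R H).
Proof.
split; [exact: innerDl|exact: innerZl|exact: innerC| |].
  by move=> x; rewrite innerE -rnormE -rmorphXn/= exprn_ge0// rnorm_ge0.
move=> x; rewrite innerE -rnormE -rmorphXn/= => /eqP.
by rewrite expf_eq0/= => /eqP/rnorm_eq0.
Qed.

Lemma innerZr (k : R[i]) x y : inner x (k *: y) = Num.conj k * inner x y.
Proof. exact: (ipZr inner_hilbert). Qed.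

Lemma innerNr x y : inner x (- y) = - inner x y.
Proof. by rewrite -scaleN1r innerZr rmorphN rmorph1 mulN1r. Qed.

Lemma inner0l y : inner 0 y = 0.
Proof. by rewrite -(scale0r (0 : H)) innerZl mul0r. Qed.

Lemma sqr_rnorm x : rnorm x ^+ 2 = complex.Re (inner x x).
Proof. by rewrite innerE -rnormE -rmorphXn. Qed.

Lemma ipnormE x : ipnorm (@inner R H) x = rnorm x.
Proof. by rewrite /ipnorm -sqr_rnorm sqrtr_sqr ger0_norm// rnorm_ge0. Qed.

Lemma sqr_rnormD x y :
  rnorm (x + y) ^+ 2 = rnorm x ^+ 2 + rnorm y ^+ 2
                       + 2 * complex.Re (inner x y).
Proof. by rewrite -!ipnormE (sqr_ipnormD inner_hilbert). Qed.

Lemma sqr_rnormB x y :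
  rnorm (x - y) ^+ 2 = rnorm x ^+ 2 + rnorm y ^+ 2
                       - 2 * complex.Re (inner x y).
Proof. by rewrite sqr_rnormD rnormN innerNr ReN mulrN. Qed.

Lemma re_inner_le x y : complex.Re (inner x y) <= rnorm x * rnorm y.
Proof. by rewrite -!ipnormE (re_ip_le inner_hilbert). Qed.

Lemma rnormZr (r : R) x : rnorm (r%:C *: x) = `|r| * rnorm x.
Proof. by rewrite -!ipnormE (ipnormZr inner_hilbert). Qed.

Lemma inner_re0 x y : complex.Re (inner x y) = 0 ->
  complex.Re (inner x ('i%C *: y)) = 0 -> inner x y = 0.
Proof.
rewrite innerZr Re_conjiM => h1 h2; apply/eqP.
by rewrite eq_complex h1 h2 !eqxx.
Qed.

End hilbert.

(** * Orthogonal decomposition along the range of an isometry *)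

Lemma ler_addgeo (R : realType) (a b c : R) : 0 <= c ->
  (forall k, a <= b + c * 2^-1 ^+ k) -> a <= b.
Proof.
move=> c0 h; apply/ler_addgt0Pr => e e0.
have c1 : 0 < c + 1 by rewrite ltr_wpDl.
have /geo2_small[k hk] : 0 < e / (c + 1) by exact: divr_gt0.
apply: (le_trans (h k)); rewrite lerD2l; rewrite ltr_pdivlMr// in hk.
by have := geo2_gt0 R k; move: hk; set g := _ ^+ k; nra.
Qed.

Section range_projection.
Variables (R : realType) (H : hilbertType R) (K : bop H).
Hypothesis isoK : forall x, `|K x| = `|x|.

Lemma rnorm_iso x : rnorm (K x) = rnorm x.
Proof. by rewrite /rnorm isoK. Qed.

(** By the parallelogram law a sequence K y_k whose distances to x tend to the
    infimum is Cauchy; K being isometric, so is (y_k), and its limit works. *)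
Lemma nearest_in_range x : exists y, forall z,
  rnorm (x - K y) <= rnorm (x - K z).
Proof.
pose E := [set rnorm (x - K y) ^+ 2 | y in [set: H]].
have infE : has_inf E.
  split; first by exists (rnorm (x - K 0) ^+ 2), 0.
  by exists 0 => _ [y _ <-]; exact: sqr_ge0.
pose d := inf E.
have dle z : d <= rnorm (x - K z) ^+ 2.
  by apply: ge_inf; [exact: infE.2|exists z].
have d0 : 0 <= d.
  by apply: lb_le_inf; [exact: infE.1|move=> _ [y _ <-]; exact: sqr_ge0].
have /choice[y yP] k : exists y, rnorm (x - K y) ^+ 2 < d + (2^-1 ^+ k) ^+ 2.
  have g0 : 0 < (2^-1 ^+ k : R) ^+ 2 by rewrite exprn_gt0// geo2_gt0.
  by have [_ [y _ <-] h] := inf_adherent g0 infE; exists y.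
have [|l hl] := @complete_geo _ H y 2.
  move=> k; rewrite -rnorm_iso linearB.
  rewrite -(ler_pXn2r (ltn0Sn 1)) ?nnegrE ?rnorm_ge0 ?mulr_ge0//.
  pose m := (2^-1)%:C *: (y k.+1 + y k).
  (* the parallelogram law, applied at the midpoint m *)
  have e : rnorm (K (y k.+1) - K (y k)) ^+ 2 = 2 * rnorm (x - K (y k)) ^+ 2
      + 2 * rnorm (x - K (y k.+1)) ^+ 2 - 4 * rnorm (x - K m) ^+ 2.
    set a := x - K (y k); set b := x - K (y k.+1).
    have -> : K (y k.+1) - K (y k) = a - b.
      by rewrite /a /b opprB [RHS]addrC subrKA.
    have -> : x - K m = (2^-1)%:C *: (a + b).
      have -> : a + b = (x + x) - K (y k.+1 + y k).
        by rewrite /a /b linearD addrACA -opprD [K (y k) + _]addrC.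
      rewrite /m linearZ scalerBr; congr (_ - _).
      rewrite -mulr2n -(scaler_nat 2 x) scalerA -(rmorph_nat (real_complex R)).
      by rewrite -rmorphM/= mulVf// scale1r.
    rewrite rnormZr exprMn ger0_norm ?invr_ge0// (sqr_rnormB a) (sqr_rnormD a).
    set p := rnorm a; set q := rnorm b; set r := complex.Re _; lra.
  rewrite e; have := dle m; have := yP k; have := yP k.+1; rewrite !exprS expr0.
  have := geo2_gt0 R k; set g := _ ^+ k => h0 h1 h2 h3; nra.
exists l => z; apply: (@le_trans _ _ (Num.sqrt d)); last first.
  by rewrite -(ger0_norm (rnorm_ge0 _)) -sqrtr_sqr ler_sqrt ?sqr_ge0.
apply: (@ler_addgeo _ _ _ 5) => // k.
have h1 : rnorm (x - K (y k)) <= Num.sqrt d + 2^-1 ^+ k.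
  rewrite -(ler_pXn2r (ltn0Sn 1)) ?nnegrE ?rnorm_ge0 ?addr_ge0 ?sqrtr_ge0//.
  apply: (le_trans (ltW (yP k))); rewrite sqrrD sqr_sqrtr//.
  have := geo2_gt0 R k; have := sqrtr_ge0 d; set g := _ ^+ k.
  set s := Num.sqrt d => s0 g0; rewrite mulr2n; nra.
rewrite -(subrKA (K (y k))); apply: (le_trans (rnormD _ _)).
rewrite -linearB rnorm_iso (rnormB (y k)); have := hl k; move: h1.
by set g := _ ^+ k; lra.
Qed.

(** Orthogonality to the range is the first-order condition satisfied by a
    nearest point. *)
Lemma range_decomposition x : exists y, forall z, inner (x - K y) (K z) = 0.
Proof.
have [y yP] := nearest_in_range x; exists y.
suff re0 z : complex.Re (inner (x - K y) (K z)) <= 0.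
  have re_eq0 z : complex.Re (inner (x - K y) (K z)) = 0.
    apply/le_anti; rewrite re0/= -oppr_le0 -ReN -innerNr.
    by rewrite -(linearN K z); exact: re0.
  move=> z; apply: inner_re0; first exact: re_eq0.
  have <- : K ('i%C *: z) = 'i%C *: K z by exact: linearZ.
  exact: re_eq0.
set u := x - K y; set r := complex.Re _; rewrite leNgt; apply/negP => r0.
pose n := rnorm (K z) ^+ 2; pose t := r / (n + 1).
have n0 : 0 <= n by exact: sqr_ge0.
have n1 : 0 < n + 1 by rewrite ltr_wpDl.
have : rnorm u ^+ 2 <= rnorm (u - t%:C *: K z) ^+ 2.
  rewrite lerXn2r ?nnegrE ?rnorm_ge0//.
  have := yP (y + t%:C *: z); rewrite linearD linearZ /=.
  by rewrite opprD addrA.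
rewrite (sqr_rnormB u) rnormZr exprMn real_normK ?num_real// innerZr conj_real.
rewrite Re_rM -/r -/n.
have tn : t * (n + 1) = r by rewrite /t divfK// gt_eqF.
have t0 : 0 < t by rewrite divr_gt0.
move: tn => <-; set p := rnorm u ^+ 2 => h.
have : t ^+ 2 * (2 + n) <= 0 by rewrite expr2 in h *; lra.
by rewrite pmulr_rle0 ?exprn_gt0//; lra.
Qed.

End range_projection.

(** * Finite Hilbert sums *)

Section finite_sums.
Variables (R : realType) (H : hilbertType R) (n : nat).
Implicit Types x y : 'I_n -> H.

Definition vinner x y : R[i] := \sum_i inner (x i) (y i).

Lemma vinner_re x : complex.Re (vinner x x) = \sum_i rnorm (x i) ^+ 2.
Proof. by rewrite Re_sum; apply: eq_bigr => i _; rewrite sqr_rnorm. Qed.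

Lemma inner_product_vinner : inner_product vinner.
Proof.
split=> [x y z|k x z|x y|x|x].
- by rewrite -big_split; apply: eq_bigr => i _; exact: innerDl.
- by rewrite mulr_sumr; apply: eq_bigr => i _; exact: innerZl.
- by rewrite rmorph_sum; apply: eq_bigr => i _; exact: innerC.
- by rewrite vinner_re sumr_ge0// => i _; exact: sqr_ge0.
rewrite vinner_re => /eqP; rewrite psumr_eq0 => [/allP x0|i _]; last first.
  exact: sqr_ge0.
apply/funext => i; apply: rnorm_eq0; apply/eqP.
by have := x0 i (mem_index_enum _); rewrite sqrf_eq0.
Qed.

Lemma vnormE x : vnorm x = ipnorm vinner x.
Proof. by rewrite /ipnorm vinner_re. Qed.

Lemma vnorm_ge0 x : 0 <= vnorm x.
Proof. exact: sqrtr_ge0. Qed.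

Lemma sqr_vnorm x : vnorm x ^+ 2 = \sum_i rnorm (x i) ^+ 2.
Proof. by rewrite sqr_sqrtr// sumr_ge0// => i _; exact: sqr_ge0. Qed.

Lemma vnormD x y : vnorm (fun i => x i + y i) <= vnorm x + vnorm y.
Proof. by rewrite !vnormE (ipnormD inner_product_vinner). Qed.

Lemma vnormZr (r : R) x : vnorm (fun i => r%:C *: x i) = `|r| * vnorm x.
Proof. by rewrite !vnormE (ipnormZr inner_product_vinner). Qed.

Lemma vnorm_eq0 x : vnorm x = 0 -> forall i, x i = 0.
Proof. by rewrite vnormE => /(ipnorm_eq0 inner_product_vinner) ->. Qed.

Lemma rnorm_le_vnorm x i : rnorm (x i) <= vnorm x.
Proof.
rewrite -(ger0_norm (rnorm_ge0 (x i))) -sqrtr_sqr ler_wsqrtr//.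
by rewrite (bigD1 i)//= lerDl sumr_ge0// => j _; exact: sqr_ge0.
Qed.

End finite_sums.

(** * The space of square-summable sequences *)

Section complex_series.
Variable R : realType.
Implicit Types u v : nat -> R[i].

Lemma lim_seriesM (a : R) (w : nat -> R) : cvgn (series w) ->
  limn (series (a *: w)) = a * limn (series w).
Proof. exact: lim_seriesZ. Qed.

Definition csummable u :=
  cvgn (series (fun k => complex.Re (u k)))
  /\ cvgn (series (fun k => complex.Im (u k))).

(** Real and imaginary parts are summed separately, so that the comparison test
    for real series applies. *)
Definition csum u : R[i] :=
  limn (series (fun k => complex.Re (u k)))
  +i* limn (series (fun k => complex.Im (u k))).

Lemma csumD u v : csummable u -> csummable v ->
  csum (fun k => u k + v k) = csum u + csum v.
Proof.
move=> [u1 u2] [v1 v2]; rewrite /csum.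
rewrite -[RHS]/((_ + _) +i* (_ + _)) -(lim_seriesD u1 v1) -(lim_seriesD u2 v2).
congr (limn (series _) +i* limn (series _)); apply/funext => k.
  exact: ReD.
exact: ImD.
Qed.

Lemma csumZ (k : R[i]) u : csummable u -> csum (fun n => k * u n) = k * csum u.
Proof.
case: k => a b [u1 u2]; rewrite /csum.
rewrite -[RHS]/((_ - _) +i* (_ + _)) -(lim_seriesM a u1) -(lim_seriesM b u2).
rewrite -(lim_seriesM a u2) -(lim_seriesM b u1).
have au1 := @is_cvg_seriesZ _ _ a u1; have au2 := @is_cvg_seriesZ _ _ a u2.
have bu1 := @is_cvg_seriesZ _ _ b u1; have bu2 := @is_cvg_seriesZ _ _ b u2.
rewrite -(lim_seriesB au1 bu2) -(lim_seriesD au2 bu1).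
by congr (limn (series _) +i* limn (series _)); apply/funext => n;
  rewrite !fctE/=; case: (u n).
Qed.

Lemma csumC u : csummable u ->
  csum (fun k => Num.conj (u k)) = Num.conj (csum u).
Proof.
move=> [u1 u2]; rewrite /csum conjE/= -(lim_seriesN u2).
by congr (limn (series _) +i* limn (series _)); apply/funext => k;
  rewrite conjE.
Qed.

End complex_series.

Section square_summable.
Variables (R : realType) (H : hilbertType R).

Definition l2_pred : {pred (nat -> H)} := fun f =>
  `[< exists M : R, forall n, \sum_(k < n) rnorm (f k) ^+ 2 <= M >].

Record l2 := L2 { l2_fun :> nat -> H; l2_funP : l2_pred l2_fun }.

HB.instance Definition _ := [isSub for l2_fun].
HB.instance Definition _ := [Choice of l2 by <:].

Lemma sqr_rnormD_le (x y : H) :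
  rnorm (x + y) ^+ 2 <= 2 * rnorm x ^+ 2 + 2 * rnorm y ^+ 2.
Proof.
have := sqr_ge0 (rnorm (x - y)); rewrite sqr_rnormB sqr_rnormD.
set a := rnorm x; set b := rnorm y; set c := complex.Re _; lra.
Qed.

Fact l2_submod : submod_closed l2_pred.
Proof.
split.
  apply/asboolP; exists 0 => n; rewrite big1// => k _.
  by rewrite -[X in rnorm X]/(0 : H) rnorm0 expr0n.
move=> k f g /asboolP[M fM] /asboolP[N gN]; apply/asboolP.
pose c := complex.Re `|k| ^+ 2.
exists (2 * (c * M) + 2 * N) => n.
apply: (@le_trans _ _ (\sum_(i < n) (2 * (c * rnorm (f i) ^+ 2)
                                    + 2 * rnorm (g i) ^+ 2))).
  apply: ler_sum => i _; rewrite !fctE (le_trans (sqr_rnormD_le _ _))//.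
  by rewrite rnormZ exprMn.
rewrite big_split -!mulr_sumr lerD// ler_wpM2l// ler_wpM2l//.
exact: sqr_ge0.
Qed.

HB.instance Definition _ :=
  GRing.isSubmodClosed.Build R[i] (nat -> H) l2_pred l2_submod.
HB.instance Definition _ := [SubChoice_isSubLmodule of l2 by <:].

Implicit Types f g h : l2.

Lemma l2P f g : (forall k, f k = g k) -> f = g.
Proof. by move=> fg; apply/val_inj/funext. Qed.

Lemma l2D f g k : (f + g) k = f k + g k. Proof. by []. Qed.
Lemma l2B f g k : (f - g) k = f k - g k. Proof. by []. Qed.
Lemma l2Z (a : R[i]) f k : (a *: f) k = a *: f k. Proof. by []. Qed.

Lemma l2_series_homo (f : nat -> H) :
  {homo series (fun k => rnorm (f k) ^+ 2) : n m / (n <= m)%N >-> n <= m}.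
Proof.
by apply: nondecreasing_series => k _ _; exact: sqr_ge0.
Qed.

Lemma cvg_sqr_rnorm f : cvgn (series (fun k => rnorm (f k) ^+ 2)).
Proof.
apply: nondecreasing_is_cvgn; first exact: l2_series_homo.
have /asboolP[M fM] := l2_funP f; exists M => _ [n _ <-].
by rewrite /series/= big_mkord.
Qed.

Lemma cvg_re_inner f g :
  cvgn (series (fun k => complex.Re (inner (f k) (g k)))).
Proof.
apply: (@normed_cvg _ R^o).
apply: (@series_le_cvg _ _
  (fun k => rnorm (f k) ^+ 2 + rnorm (g k) ^+ 2)) => [k|k|k|].
- exact: normr_ge0.
- by rewrite addr_ge0// sqr_ge0.
- have := re_inner_le (f k) (g k); have := re_inner_le (f k) (- g k).
  rewrite innerNr ReN rnormN /= ler_norml.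
  set a := rnorm (f k); set b := rnorm (g k); set c := complex.Re _.
  by move=> h1 h2; apply/andP; split; nra.
by apply: is_cvg_seriesD; exact: cvg_sqr_rnorm.
Qed.

Lemma csummable_inner f g : csummable (fun k => inner (f k) (g k)).
Proof.
split; first exact: cvg_re_inner.
have := @cvg_re_inner f ('i%C *: g).
by under eq_fun do rewrite l2Z innerZr Re_conjiM.
Qed.

Definition l2_inner f g : R[i] := csum (fun k => inner (f k) (g k)).

Lemma l2_inner_re f :
  complex.Re (l2_inner f f) = limn (series (fun k => rnorm (f k) ^+ 2)).
Proof.
by congr (limn (series _)); apply/funext => k; rewrite sqr_rnorm.
Qed.

Lemma partial_le_l2 f n :
  \sum_(k < n) rnorm (f k) ^+ 2 <= complex.Re (l2_inner f f).
Proof.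
have := nondecreasing_cvgn_le (@l2_series_homo f) (@cvg_sqr_rnorm f) n.
by rewrite l2_inner_re /series/= big_mkord.
Qed.

Lemma inner_product_l2 : inner_product l2_inner.
Proof.
have r0 f : 0 <= complex.Re (l2_inner f f).
  by apply: le_trans (partial_le_l2 f 0); rewrite big_ord0.
split=> // [f g h|a f h|f g|f f0].
- rewrite -csumD; try exact: csummable_inner.
  by congr csum; apply/funext => k; rewrite l2D innerDl.
- rewrite -csumZ; last exact: csummable_inner.
  by congr csum; apply/funext => k; rewrite l2Z innerZl.
- rewrite -csumC; last exact: csummable_inner.
  by congr csum; apply/funext => k; exact: innerC.
apply: l2P => k; apply: rnorm_eq0; apply/eqP; rewrite -sqrf_eq0.
rewrite eq_le sqr_ge0 andbT -f0 (le_trans _ (partial_le_l2 f k.+1))//.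
rewrite big_ord_recr/= lerDr sumr_ge0// => i _; exact: sqr_ge0.
Qed.

Definition l2_norm f : R[i] := (ipnorm l2_inner f)%:C.

Fact l2_normD f g : l2_norm (f + g) <= l2_norm f + l2_norm g.
Proof. by rewrite -raddfD/= lecR (ipnormD inner_product_l2). Qed.

Fact l2_normZ (a : R[i]) f : l2_norm (a *: f) = `|a| * l2_norm f.
Proof.
by rewrite /l2_norm (ipnormZ inner_product_l2) rmorphM/=; congr (_ * _).
Qed.

Fact l2_norm_eq0 f : l2_norm f = 0 -> f = 0.
Proof. by move=> /complexI /(ipnorm_eq0 inner_product_l2). Qed.

HB.instance Definition _ := Lmodule_isNormed.Build R[i] l2
  l2_normD l2_normZ l2_norm_eq0.

Lemma sqr_l2_norm f : rnorm f ^+ 2 = complex.Re (l2_inner f f).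
Proof. by rewrite -(sqr_ipnorm inner_product_l2). Qed.

Lemma l2_partial f n : \sum_(k < n) rnorm (f k) ^+ 2 <= rnorm f ^+ 2.
Proof. by rewrite sqr_l2_norm partial_le_l2. Qed.

Lemma l2_norm_le f (M : R) :
  (forall n, \sum_(k < n) rnorm (f k) ^+ 2 <= M) -> rnorm f ^+ 2 <= M.
Proof.
move=> fM; rewrite sqr_l2_norm l2_inner_re; apply: limr_le.
  exact: cvg_sqr_rnorm.
by apply: nearW => n; rewrite /series/= big_mkord.
Qed.

Lemma l2_norm_coord f k : rnorm (f k) <= rnorm f.
Proof.
rewrite -(ler_pXn2r (ltn0Sn 1)) ?nnegrE ?rnorm_ge0//.
apply: le_trans (l2_partial f k.+1); rewrite big_ord_recr/= lerDr.
by rewrite sumr_ge0// => i _; exact: sqr_ge0.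
Qed.

End square_summable.

Section completeness.
Variables (R : realType) (V : normedModType R[i]).

Lemma geo_tail (u : nat -> V) (M : R) :
  (forall k, rnorm (u k.+1 - u k) <= M * 2^-1 ^+ k) ->
  forall k n, rnorm (u (k + n)%N - u k) <= M * 2 * 2^-1 ^+ k.
Proof.
move=> uM k n.
suff h : rnorm (u (k + n)%N - u k) <=
    M * 2 * 2^-1 ^+ k - M * 2 * 2^-1 ^+ (k + n).
  apply: le_trans h _; rewrite gerBl; apply: mulr_ge0.
    by have := le_trans (rnorm_ge0 _) (uM 0%N); rewrite expr0; lra.
  exact/ltW/(geo2_gt0 R).
elim: n => [|n IH]; first by rewrite addn0 subrr rnorm0 subrr.
rewrite addnS -(subrKA (u (k + n)%N)) (le_trans (rnormD _ _))//.
have := uM (k + n)%N; rewrite exprS; move: IH.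
set a := _ ^+ k; set b := _ ^+ (k + n); set p := rnorm _; set q := rnorm _.
by move=> h1 h2; lra.
Qed.

(** A Cauchy filter contains a ball of radius 2^-k for every k, and the centres
    of these balls form a sequence as in the hypothesis. *)
Lemma cauchy_cvg_of_geo :
  (forall u : nat -> V, (forall k, rnorm (u k.+1 - u k) <= 2 * 2^-1 ^+ k) ->
     exists l, forall k, rnorm (l - u k) <= 4 * 2^-1 ^+ k) ->
  forall F : set_system V, ProperFilter F -> cauchy F -> cvg F.
Proof.
move=> geo F FF /cauchyP cF.
have /choice[x Fx] k : exists x : V, F (ball x (2^-1 ^+ k : R)%:C).
  by apply: cF; rewrite ltcR geo2_gt0.
have [|l hl] := geo x.
  move=> k.
  have [y [/rball h1 /rball h2]] := filter_ex (filterI (Fx k) (Fx k.+1)).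
  rewrite -(subrKA y) (le_trans (rnormD _ _))//.
  rewrite rnormB in h1; move: h1 h2; rewrite exprS.
  have := geo2_gt0 R k; set g := _ ^+ k; set p := rnorm _; set q := rnorm _.
  by move=> h1 h2 h3; lra.
apply/cvg_ex; exists l; apply/cvgrPdist_lt => e /gt0_realC[r r0 ->].
have /geo2_small[k hk] : 0 < r / 5 by rewrite divr_gt0.
apply: filterS (Fx k) => y /rball xy; rewrite -rnormE ltcR.
rewrite -(subrKA (x k)) (le_lt_trans (rnormD _ _))//.
have := hl k; rewrite ltr_pdivlMr// in hk; move: hk xy; set g := _ ^+ k.
by set p := rnorm _; set q := rnorm _ => h1 h2 h3; lra.
Qed.

End completeness.

Section l2_hilbert.
Variables (R : realType) (H : hilbertType R).

Lemma vnorm_le_const n (x : 'I_n -> H) (c : R) : 0 <= c ->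
  (forall i, rnorm (x i) <= c) -> vnorm x <= Num.sqrt n%:R * c.
Proof.
move=> c0 xc; rewrite -{1}(ger0_norm c0) -sqrtr_sqr -sqrtrM ?ler0n//.
rewrite ler_wsqrtr// -[n in n%:R]card_ord -sum1_card natr_sum mulr_suml.
apply: ler_sum => i _; rewrite mul1r lerXn2r ?nnegrE ?rnorm_ge0//.
Qed.

Lemma l2_vnorm (f : l2 H) n : vnorm (fun i : 'I_n => f i) <= rnorm f.
Proof.
rewrite -(ger0_norm (rnorm_ge0 f)) -sqrtr_sqr ler_wsqrtr//.
exact: l2_partial.
Qed.

(** The coordinatewise limit l is a limit in norm: the first N coordinates of
    l - u k are those of u (k + m) - u k, which are controlled uniformly in N,
    up to an error that vanishes as m grows. *)
Lemma l2_geo (u : nat -> l2 H) :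
  (forall k, rnorm (u k.+1 - u k) <= 2 * 2^-1 ^+ k) ->
  exists l, forall k, rnorm (l - u k) <= 4 * 2^-1 ^+ k.
Proof.
move=> uM.
have g0 k : 0 <= 4 * 2^-1 ^+ k :> R by rewrite mulr_ge0// ltW// geo2_gt0.
have /choice[l lP] n : exists y : H, forall k,
    rnorm (y - u k n) <= 4 * 2^-1 ^+ k.
  have [|y hy] := @complete_geo _ H (fun k => u k n) 2.
    by move=> k; rewrite -l2B (le_trans (l2_norm_coord _ _)).
  by exists y => k; apply: le_trans (hy k) _; lra.
have vl k N : vnorm (fun i : 'I_N => l i - u k i) <= 4 * 2^-1 ^+ k.
  apply: (@ler_addgeo _ _ _ (Num.sqrt N%:R * 4)).
    by rewrite mulr_ge0// sqrtr_ge0.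
  move=> m; have -> : (fun i : 'I_N => l i - u k i) =
      (fun i => (u (k + m)%N i - u k i) + (l i - u (k + m)%N i)).
    by apply/funext => i; rewrite [RHS]addrC subrKA.
  apply: le_trans (vnormD _ _) _; apply: lerD.
    apply: le_trans (l2_vnorm (u (k + m)%N - u k) N) _.
    by have := geo_tail uM k m; lra.
  rewrite -mulrA; apply: le_trans (vnorm_le_const (g0 m) _) _ => [i|//].
  apply: le_trans (lP _ _) _; rewrite ler_wpM2l// exprD.
  have := geo2_gt0 R m; set g := _ ^+ m => gm; rewrite ler_piMl ?(ltW gm)//.
  by rewrite exprn_ile1// ?invr_ge0// invf_le1// ler1n.
have lk k n : \sum_(i < n) rnorm (l i - u k i) ^+ 2 <= (4 * 2^-1 ^+ k) ^+ 2.
  rewrite -(sqr_vnorm (fun i : 'I_n => l i - u k i)).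
  by rewrite lerXn2r ?nnegrE ?vnorm_ge0.
have l_l2 : l2_pred l.
  apply/asboolP.
  exists (2 * (4 * 2^-1 ^+ 0) ^+ 2 + 2 * rnorm (u 0%N) ^+ 2) => n.
  apply: le_trans (lerD (ler_wpM2l _ (lk 0%N n))
    (ler_wpM2l _ (l2_partial (u 0%N) n))) => //.
  rewrite !mulr_sumr -big_split; apply: ler_sum => i _.
  by rewrite -{1}(subrK (u 0%N i) (l i)) sqr_rnormD_le.
exists (L2 l_l2) => k; rewrite -(ler_pXn2r (ltn0Sn 1)) ?nnegrE ?rnorm_ge0//.
by apply: l2_norm_le => n; exact: lk.
Qed.

HB.instance Definition _ :=
  Uniform_isComplete.Build (l2 H) (cauchy_cvg_of_geo l2_geo).

Fact l2_innerE (f : l2 H) : l2_inner f f = `|f| ^+ 2.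
Proof.
rewrite -rnormE -rmorphXn/= sqr_l2_norm.
have := ipC (inner_product_l2 H) f f; rewrite conjE.
case: (l2_inner f f) => a b /= [] /eqP.
by rewrite -addr_eq0 -mulr2n mulrn_eq0/= => /eqP ->.
Qed.

HB.instance Definition _ := isHilbert.Build R (l2 H)
  (ipDl (inner_product_l2 H)) (ipZl (inner_product_l2 H))
  (ipC (inner_product_l2 H)) l2_innerE.

Definition l2_hilbert : hilbertType R := l2 H.

End l2_hilbert.

(** * Bounded operators and operator matrices *)

Section bounded.
Variables (R : realType) (H : hilbertType R).
Implicit Types (S T : bop H) (x y : H).

Lemma bounded_bop_pred (f : H -> H) (M : R) : linear f ->
  (forall x, rnorm (f x) <= M * rnorm x) -> bop_pred f.
Proof.
move=> lf fM; apply/asboolP; split => // x.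
apply/cvgrPdist_lt => e /gt0_realC[r r0 ->].
have fB y : rnorm (f x - f y) <= M * rnorm (x - y).
  have := lf (-1) y x; rewrite !scaleN1r.
  rewrite [- y + x]addrC [- f y + f x]addrC => <-.
  exact: fM.
have M0 : 0 < `|M| + 1 by rewrite ltr_wpDl.
apply/nbhs_ballP; exists (r / (`|M| + 1))%:C => /=.
  by rewrite ltcR divr_gt0.
move=> y /rball; rewrite ltr_pdivlMr// -rnormE ltcR => h.
apply: le_lt_trans (fB y) _; apply: le_lt_trans h; rewrite mulrC.
by rewrite ler_wpM2l ?rnorm_ge0// (le_trans (ler_norm _))// lerDl.
Qed.

Lemma bop_bounded T :
  exists2 M : R, 0 <= M & forall x, rnorm (T x) <= M * rnorm x.
Proof.
have /linear_bounded_continuous/linear_boundedP := @bop_continuous _ _ T.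
move=> [c [creal hc]].
have c1 : c < `|c| + 1 by rewrite (le_lt_trans (real_ler_norm creal))// ltrDl.
have cE : (complex.Re (`|c| + 1))%:C = `|c| + 1.
  by rewrite RRe_real// ger0_real// addr_ge0.
exists (complex.Re (`|c| + 1)); first by rewrite -ler0c cE addr_ge0.
by move=> x; rewrite -lecR rmorphM/= !rnormE cE; exact: hc.
Qed.

Lemma bopP S T : (forall x, S x = T x) -> S = T.
Proof. by move=> ST; apply/val_inj/funext. Qed.

Lemma bopD S T x : (S + T) x = S x + T x. Proof. by []. Qed.
Lemma bopB S T x : (S - T) x = S x - T x. Proof. by []. Qed.
Lemma bopZ (a : R[i]) T x : (a *: T) x = a *: T x. Proof. by []. Qed.
Lemma bop0 x : (0 : bop H) x = 0. Proof. by []. Qed.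

Lemma bop_sum (I : Type) (s : seq I) (P : pred I) (F : I -> bop H) x :
  (\sum_(i <- s | P i) F i) x = \sum_(i <- s | P i) F i x.
Proof. by elim/big_rec2 : _ => // i y1 y2 _ <-. Qed.

(** The pointwise limit is bounded since L x stays within a fixed multiple of
    |x| of T 0 x. *)
Lemma bop_geo_limit (T : nat -> bop H) (M : R) :
  (forall k x, rnorm (T k.+1 x - T k x) <= M * 2^-1 ^+ k * rnorm x) ->
  exists L : bop H, forall k x,
    rnorm (L x - T k x) <= M * 2 * 2^-1 ^+ k * rnorm x.
Proof.
move=> TM; have /choice[L LP] x : exists y : H, forall k,
    rnorm (y - T k x) <= M * 2 * 2^-1 ^+ k * rnorm x.
  have [|y hy] := @complete_geo _ H (fun k => T k x) (M * rnorm x).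
    by move=> k; rewrite mulrAC.
  by exists y => k; apply: le_trans (hy k) _; lra.
have c0 x : 0 <= M * 2 * rnorm x.
  by have := le_trans (rnorm_ge0 _) (LP x 0%N); rewrite expr0 mulr1.
have linL : linear L.
  move=> a x y; apply/subr0_eq/rnorm_eq0/le_anti; rewrite rnorm_ge0 andbT.
  set w := a *: x + y; pose b := complex.Re `|a|.
  have b0 : 0 <= b by rewrite -ler0c RRe_real// normr_real.
  apply: (@ler_addgeo _ _ _ (M * 2 * rnorm w + b * (M * 2 * rnorm x)
                             + M * 2 * rnorm y)).
    by rewrite !addr_ge0// mulr_ge0.
  move=> k; have -> : L w - (a *: L x + L y) =
      (L w - T k w) - (a *: (L x - T k x) + (L y - T k y)).
    rewrite scalerBr addrACA -opprD -linearP -/w.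
    by rewrite opprB addrA subrK.
  apply: le_trans (rnormD _ _) _; rewrite rnormN.
  have := LP w k; have := LP y k; have := ler_wpM2l b0 (LP x k).
  rewrite -rnormZ => h1 h2 h3.
  have := rnormD (a *: (L x - T k x)) (L y - T k y); rewrite add0r; lra.
have LB : exists N, forall x, rnorm (L x) <= N * rnorm x.
  have [N _ hN] := bop_bounded (T 0%N); exists (M * 2 + N) => x.
  rewrite -(subrK (T 0%N x) (L x)); apply: le_trans (rnormD _ _) _.
  by have := LP x 0%N; have := hN x; rewrite expr0; lra.
have [N hN] := LB; exists (Bop (bounded_bop_pred linL hN)) => k x.
exact: LP.
Qed.

End bounded.

Section matrix_norms.
Variables (R : realType) (H : hilbertType R) (n : nat).
Implicit Types (S T : 'M[bop H]_n).

Definition mxapp T (x : 'I_n -> H) : 'I_n -> H := fun i => \sum_j T i j (x j).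

Lemma op_mxnorm_ge0 T : (0 <= op_mxnorm T)%E.
Proof.
apply: ereal_sup_ubound => /=; exists (fun=> 0).
  by rewrite /= /vnorm big1 ?sqrtr0// => i _; rewrite rnorm0 expr0n.
rewrite /vnorm big1 ?sqrtr0// => i _; rewrite big1 ?rnorm0 ?expr0n// => j _.
exact: linear0.
Qed.

Lemma op_mxnorm_le T (B : R) : 0 <= B ->
  (op_mxnorm T <= B%:E)%E <-> forall x, vnorm (mxapp T x) <= B * vnorm x.
Proof.
move=> B0; split=> [TB x|TB]; last first.
  apply: ge_ereal_sup => _ [x /= x1 <-]; rewrite lee_fin.
  by apply: le_trans (TB x) _; rewrite ler_piMr.
have [x0|x0] := eqVneq (vnorm x) 0.
  rewrite x0 mulr0 /vnorm big1 ?sqrtr0// => i _.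
  rewrite /mxapp big1 ?rnorm0 ?expr0n// => j _.
  by rewrite (vnorm_eq0 x0) linear0.
have px : 0 < vnorm x by rewrite lt0r x0 vnorm_ge0.
pose y i := (vnorm x)^-1%:C *: x i.
have y1 : vnorm y <= 1.
  by rewrite vnormZr ger0_norm ?invr_ge0 ?vnorm_ge0// mulVf.
have : ((vnorm (mxapp T y))%:E <= B%:E)%E.
  by apply: le_trans TB; apply: ereal_sup_ubound; exists y.
rewrite lee_fin; have -> : mxapp T y = fun i => (vnorm x)^-1%:C *: mxapp T x i.
  apply/funext => i; rewrite /mxapp scaler_sumr; apply: eq_bigr => j _.
  exact: linearZ.
rewrite vnormZr ger0_norm ?invr_ge0 ?vnorm_ge0//.
by rewrite ler_pdivrMl// mulrC.
Qed.

Lemma mxappD S T x i : mxapp (S + T) x i = mxapp S x i + mxapp T x i.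
Proof. by rewrite -big_split; apply: eq_bigr => j _; rewrite mxE. Qed.

Lemma op_mxnormD S T (B D : R) : 0 <= B -> 0 <= D ->
  (op_mxnorm S <= B%:E)%E -> (op_mxnorm T <= D%:E)%E ->
  (op_mxnorm (S + T) <= (B + D)%:E)%E.
Proof.
move=> B0 D0 /(op_mxnorm_le S B0) SB /(op_mxnorm_le T D0) TD.
apply/op_mxnorm_le => [|x]; first exact: addr_ge0.
rewrite (_ : mxapp _ x = fun i => mxapp S x i + mxapp T x i); last first.
  by apply/funext => i; rewrite mxappD.
by rewrite (le_trans (vnormD _ _))// mulrDl lerD.
Qed.

(** This crude constant suffices to pass from approximations of the entries to
    approximations of the matrix. *)
Lemma op_mxnorm_entries T (e : R) : 0 <= e ->
  (forall i j x, rnorm (T i j x) <= e * rnorm x) ->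
  (op_mxnorm T <= (Num.sqrt n%:R * n%:R * e)%:E)%E.
Proof.
move=> e0 Te; apply/op_mxnorm_le => [|x].
  by rewrite !mulr_ge0 ?sqrtr_ge0 ?ler0n.
rewrite -!mulrA; apply: vnorm_le_const => [|i].
  by rewrite !mulr_ge0 ?ler0n ?vnorm_ge0.
rewrite /mxapp.
apply: (@le_trans _ _ (\sum_(j < n) (e * vnorm x))); last first.
  by rewrite sumr_const card_ord mulr_natl.
apply: (@le_trans _ _ (\sum_(j < n) rnorm (T i j (x j)))).
  elim/big_rec2 : _ => [|j a b _ h]; first by rewrite rnorm0.
  by rewrite (le_trans (rnormD _ _))// lerD2l.
apply: ler_sum => j _; rewrite (le_trans (Te _ _ _))//.
by rewrite ler_wpM2l// rnorm_le_vnorm.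
Qed.

End matrix_norms.

Section families.
Variables (R : realType) (I : Type) (H : I -> hilbertType R).
Implicit Types F G : opfam H.

Lemma fam_mxnorm_le n (M : 'I_n -> 'I_n -> opfam H) (B : \bar R) :
  (fam_mxnorm M <= B)%E <->
  forall i, (op_mxnorm (\matrix_(k, l) M k l i) <= B)%E.
Proof.
split=> [MB i|MB]; last by apply: ge_ereal_sup => _ [i ->].
by apply: le_trans MB; apply: ereal_sup_ubound; exists i.
Qed.

Lemma fam_norm_le F (B : R) : 0 <= B ->
  (fam_norm F <= B%:E)%E <-> forall i x, rnorm (F i x) <= B * rnorm x.
Proof.
have v1 (V : hilbertType R) (x : 'I_1 -> V) : vnorm x = rnorm (x ord0).
  by rewrite /vnorm big_ord1 sqrtr_sqr ger0_norm ?rnorm_ge0.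
move=> B0; split=> [/fam_mxnorm_le FB i x|FB].
  have /(op_mxnorm_le _ B0)/(_ (fun=> x)) := FB i.
  by rewrite !v1 /mxapp big_ord1 mxE.
apply/fam_mxnorm_le => i; apply/(op_mxnorm_le _ B0) => x.
by rewrite !v1 /mxapp big_ord1 mxE.
Qed.

End families.

(** * Uniform boundedness of representations *)

Section representations.
Variables (R : realType) (C : cstarType R) (H : hilbertType R).
Variable pi : unitalStarRep C H.

(** Representations are contractive, but any bound independent of the
    representation will do, and the constant 2 can be had without square roots
    or spectral theory. If b is the square of the norm of S = pi(c), then
    b - S^*S is not bounded below, so 1 - c^*c/b is not invertible; for
    b > 2 |c|^2 this contradicts the convergence of the Neumann series. *)
Lemma star_rep_bounded c x : rnorm (pi c x) <= 2 * rnorm c * rnorm x.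
Proof.
pose E := [set b : R | 0 <= b /\
  forall x, rnorm (pi c x) ^+ 2 <= b * rnorm x ^+ 2].
have E0 : E !=set0.
  have [M M0 hM] := bop_bounded (pi c); exists (M ^+ 2); split.
    exact: sqr_ge0.
  move=> y; rewrite -exprMn lerXn2r ?nnegrE ?rnorm_ge0//.
  by rewrite mulr_ge0// rnorm_ge0.
have infE : has_inf E by split => //; exists 0 => b [].
(* b is the square of the operator norm of pi c *)
pose b := inf E.
have b0 : 0 <= b by apply: lb_le_inf => // ? [].
have Eb y : rnorm (pi c y) ^+ 2 <= b * rnorm y ^+ 2.
  apply/ler_addgt0Pr => e e0.
  have n1 : 0 < rnorm y ^+ 2 + 1 by rewrite ltr_wpDl// sqr_ge0.
  have [d [d0 hd] db] := inf_adherent (divr_gt0 e0 n1) infE.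
  apply: le_trans (hd y) _.
  have : d * rnorm y ^+ 2 <= (b + e / (rnorm y ^+ 2 + 1)) * rnorm y ^+ 2.
    by rewrite ler_wpM2r ?sqr_ge0// ltW.
  move/le_trans; apply; rewrite mulrDl lerD2l -mulrA ler_piMr ?(ltW e0)//.
  by rewrite ler_pdivrMl// mulr1 lerDl.
suff bc : b <= 2 * rnorm c ^+ 2.
  rewrite -(ler_pXn2r (ltn0Sn 1)) ?nnegrE ?rnorm_ge0 ?mulr_ge0 ?rnorm_ge0//.
  apply: le_trans (Eb x) _; rewrite !exprMn ler_wpM2r ?sqr_ge0//.
  by apply: le_trans bc _; rewrite ler_wpM2r ?sqr_ge0//; lra.
rewrite leNgt; apply/negP => cb.
have b1 : 0 < b by apply: le_lt_trans cb; rewrite mulr_ge0 ?sqr_ge0.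
have Eb' y : rnorm (pi (star c) y) ^+ 2 <= b * rnorm y ^+ 2.
  set z := pi (star c) y.
  have [z0|z0] := eqVneq (rnorm z) 0.
    by rewrite z0 expr0n mulr_ge0// sqr_ge0.
  have z1 : 0 < rnorm z ^+ 2 by rewrite exprn_gt0// lt0r z0 rnorm_ge0.
  rewrite -(ler_pM2r z1) [leRHS]mulrAC.
  apply: (@le_trans _ _ (rnorm (pi c z) ^+ 2 * rnorm y ^+ 2)); last first.
    by rewrite ler_wpM2r ?sqr_ge0.
  rewrite -!exprMn lerXn2r ?nnegrE ?mulr_ge0 ?rnorm_ge0//.
  rewrite -expr2 sqr_rnorm {2}/z -star_repS.
  exact: re_inner_le.
pose u := b^-1%:C *: (star c ** c).
have [|v [_ vu]] := @neumann _ _ u.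
  rewrite rnormZ rnorm_star2 (_ : complex.Re _ = b^-1); last first.
    by rewrite ger0_norm// ler0c invr_ge0.
  by rewrite ler_pdivrMl//; lra.
have [M M0 hM] := bop_bounded (pi v).
(* an inverse of 1 - c^*c/b would bound b - S^*S from below *)
have low y :
    b * rnorm y ^+ 2 <= M ^+ 2 * (b * rnorm y ^+ 2 - rnorm (pi c y) ^+ 2).
  pose w := b%:C *: y - pi (star c) (pi c y).
  have yw : b%:C *: y = pi v w.
    have -> : w = b%:C *: pi (cone - u) y.
      rewrite (_ : pi (cone - u) = bop_id H
          - b^-1%:C *: bop_comp (pi (star c)) (pi c)); last first.
        by rewrite linearB star_rep1 -star_repM linearZ.
      rewrite bopB scalerBr bopZ scalerA.
      by rewrite -rmorphM/= mulfV ?gt_eqF// scale1r.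
    rewrite linearZ; congr (_ *: _).
    have := star_repM pi v (cone - u); rewrite vu star_rep1.
    by move=> /(congr1 (fun T : bop H => T y)).
  have : b ^+ 2 * rnorm y ^+ 2 <= M ^+ 2 * rnorm w ^+ 2.
    rewrite -!exprMn lerXn2r ?nnegrE ?mulr_ge0 ?rnorm_ge0//.
    by rewrite -{1}(ger0_norm b0) -rnormZr yw.
  have : rnorm w ^+ 2 <= b * (b * rnorm y ^+ 2 - rnorm (pi c y) ^+ 2).
    rewrite sqr_rnormB rnormZr ger0_norm// innerZl Re_rM.
    rewrite -star_repS -sqr_rnorm exprMn; have := Eb' (pi c y).
    by set p := rnorm y ^+ 2; set q := rnorm (pi c y) ^+ 2; lra.
  move=> /(ler_wpM2l (sqr_ge0 M)) h1 /le_trans/(_ h1) h2.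
  rewrite -(ler_pM2l b1) mulrA -expr2; apply: le_trans h2 _.
  by rewrite mulrCA.
(* the lower bound improves the constant b by a factor t < 1 *)
pose t := M ^+ 2 / (1 + M ^+ 2).
have M1 : 0 < 1 + M ^+ 2 by rewrite ltr_wpDr ?sqr_ge0.
have : b <= t * b.
  apply: ge_inf; first exact: infE.2.
  split; first by rewrite mulr_ge0 ?divr_ge0 ?sqr_ge0// ltW.
  move=> y; rewrite -mulrA /t mulrAC ler_pdivlMr//.
  have := low y; have := Eb y.
  by set p := rnorm y ^+ 2; set q := rnorm (pi c y) ^+ 2; lra.
rewrite -{1}(mul1r b) ler_pM2r// /t ler_pdivlMr//.
by lra.
Qed.

End representations.

(** * The left regular covariant pair *)

Section rep_comp.
Variables (R : realType) (C D : cstarType R) (H : hilbertType R).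
Variables (f : unitalStarHom C D) (pi : unitalStarRep D H).

Fact rep_comp1 : (pi \o f) cone = bop_id H.
Proof. by rewrite /= star_hom1 star_rep1. Qed.

Fact rep_compM a b : (pi \o f) (a ** b) = bop_comp ((pi \o f) a) ((pi \o f) b).
Proof. by rewrite /= star_homM star_repM. Qed.

Fact rep_compS a x y :
  inner ((pi \o f) a x) y = inner x ((pi \o f) (star a) y).
Proof. by rewrite /= star_homS star_repS. Qed.

Definition rep_comp : unitalStarRep C H :=
  @UnitalStarRep R C H (pi \o f) rep_comp1 rep_compM rep_compS.

End rep_comp.

Section sequence_operators.
Variables (R : realType) (H : hilbertType R).
Implicit Types f g : l2_hilbert H.

Lemma l2_sum (I : Type) (s : seq I) (P : pred I) (F : I -> l2 H) k :
  (\sum_(i <- s | P i) F i) k = \sum_(i <- s | P i) F i k.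
Proof. by elim/big_rec2 : _ => // i y1 y2 _ <-. Qed.

Definition shift_fun (f : nat -> H) (k : nat) : H :=
  if k is m.+1 then f m else 0.

Lemma shift_partial (f : nat -> H) n :
  \sum_(k < n.+1) rnorm (shift_fun f k) ^+ 2 = \sum_(k < n) rnorm (f k) ^+ 2.
Proof. by rewrite big_ord_recl/= rnorm0 expr0n add0r. Qed.

Fact shift_l2 f : l2_pred (shift_fun f).
Proof.
apply/asboolP; exists (rnorm f ^+ 2) => -[|n].
  by rewrite big_ord0 sqr_ge0.
by rewrite shift_partial l2_partial.
Qed.

Definition l2_shift f : l2_hilbert H := L2 (shift_l2 f).

Lemma rnorm_shift f : rnorm (l2_shift f) = rnorm f.
Proof.
apply/eqP; rewrite -(@eqrXn2 _ 2) ?rnorm_ge0// eq_le; apply/andP; split.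
  apply: l2_norm_le => -[|n]; first by rewrite big_ord0 sqr_ge0.
  by rewrite shift_partial l2_partial.
apply: l2_norm_le => n; rewrite -shift_partial.
exact: (l2_partial (l2_shift f)).
Qed.

Fact l2_shift_linear : linear l2_shift.
Proof.
move=> a f g; apply: l2P => -[|k//].
by rewrite -[RHS]/(a *: (0 : H) + (0 : H)) scaler0 addr0.
Qed.

Fact shift_bop : bop_pred l2_shift.
Proof.
apply: (@bounded_bop_pred _ _ _ 1); first exact: l2_shift_linear.
by move=> f; rewrite mul1r rnorm_shift.
Qed.

Definition shift : bop (l2_hilbert H) := Bop shift_bop.

Lemma shift_expE m f k :
  bop_exp shift m f k = if (m <= k)%N then f (k - m)%N else 0.
Proof.
elim: m k => [|m IH] k; first by rewrite subn0.
by case: k => [|k]//=; rewrite /bop_exp/= in IH *; rewrite IH.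
Qed.

Variables (T : nat -> bop H) (M : R).
Hypotheses (M0 : 0 <= M) (TM : forall k x, rnorm (T k x) <= M * rnorm x).

Lemma diag_partial f n :
  \sum_(k < n) rnorm (T k (f k)) ^+ 2 <= (M * rnorm f) ^+ 2.
Proof.
rewrite exprMn; apply: le_trans (ler_wpM2l (sqr_ge0 M) (l2_partial f n)).
rewrite mulr_sumr; apply: ler_sum => k _; rewrite -exprMn lerXn2r ?nnegrE//.
  exact: rnorm_ge0.
by rewrite mulr_ge0// rnorm_ge0.
Qed.

Fact diag_l2 f : l2_pred (fun k => T k (f k)).
Proof.
by apply/asboolP; exists ((M * rnorm f) ^+ 2) => n; exact: diag_partial.
Qed.

Definition l2_diag f : l2_hilbert H := L2 (diag_l2 f).

Fact diag_bop : bop_pred l2_diag.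
Proof.
apply: (@bounded_bop_pred _ _ _ M) => [a f g|f].
  by apply: l2P => k; exact: linearP.
rewrite -(ler_pXn2r (ltn0Sn 1)) ?nnegrE ?mulr_ge0 ?rnorm_ge0//.
by apply: l2_norm_le => n; exact: diag_partial.
Qed.

Definition diag : bop (l2_hilbert H) := Bop diag_bop.

End sequence_operators.

Section regular_pair.
Variables (R : realType) (C : cstarType R) (alpha : unitalStarHom C C).
Variables (H : hilbertType R) (pi : unitalStarRep C H).

(** The representation pi o alpha^k. As star_rep_bounded applies to it with a
    bound independent of k, the diagonal operator with entries pi(alpha^k(c))
    is bounded. *)
Definition rep_iter k : unitalStarRep C H :=
  iter k (fun rho => rep_comp alpha rho) pi.

Lemma rep_iterE k c : rep_iter k c = pi (iter k alpha c).
Proof. by elim: k c => //= k IH c; rewrite IH -iterSr. Qed.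

Lemma rep_iter_bounded c k x :
  rnorm (rep_iter k c x) <= 2 * rnorm c * rnorm x.
Proof. exact: star_rep_bounded. Qed.

Definition regular_fun (c : C) : bop (l2_hilbert H) :=
  diag (mulr_ge0 (ler0n _ 2) (rnorm_ge0 c)) (rep_iter_bounded c).

Lemma regular_funE c f k : regular_fun c f k = pi (iter k alpha c) (f k).
Proof. by rewrite -rep_iterE. Qed.

Fact regular_linear : linear regular_fun.
Proof.
move=> a b c; apply: bopP => f; apply: l2P => k.
by rewrite -[LHS]/(rep_iter k (a *: b + c) (f k)) linearP.
Qed.

HB.instance Definition _ :=
  GRing.isLinear.Build R[i] C (bop (l2_hilbert H)) *:%R regular_fun
    regular_linear.

Fact regular1 : regular_fun cone = bop_id (l2_hilbert H).
Proof. by apply: bopP => f; apply: l2P => k /=; rewrite star_rep1. Qed.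

Fact regularM a b :
  regular_fun (a ** b) = bop_comp (regular_fun a) (regular_fun b).
Proof. by apply: bopP => f; apply: l2P => k /=; rewrite star_repM. Qed.

Fact regularS a f g :
  inner (regular_fun a f) g = inner f (regular_fun (star a) g).
Proof. by congr csum; apply/funext => k /=; rewrite star_repS. Qed.

Definition regular_rep : unitalStarRep C (l2_hilbert H) :=
  @UnitalStarRep R C (l2_hilbert H) regular_fun regular1 regularM regularS.

Fact shift_isometric f : `|shift H f| = `|f|.
Proof. by rewrite -!rnormE (rnorm_shift f). Qed.

Fact regular_covariant c : bop_comp (regular_rep c) (shift H) =
  bop_comp (shift H) (regular_rep (alpha c)).
Proof.
by apply: bopP => f; apply: l2P => -[|k] /=; rewrite ?linear0.
Qed.

(** On l2(N, H) an element c acts as pi(alpha^k(c)) on the coordinate k and the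
    isometry is the unilateral shift. *)
Definition regular_pair : covariantPair alpha :=
  CovariantPair shift_isometric regular_covariant.

(** The coordinate i of the image of y under the lower triangular operator with
    entries pi(alpha^j(a_{i-j})), which is the value at the regular pair of the
    polynomial with coefficients a. *)
Definition toeplitz (a : nat -> C) (y : nat -> H) (i : nat) : H :=
  \sum_(j < i.+1) pi (iter j alpha (a (i - j)%N)) (y j).

Lemma sc_poly_regular k (a : nat -> C) (f : l2_hilbert H) i :
  (forall m, (k < m)%N -> a m = 0) ->
  (sc_poly k a regular_pair f : l2 H) i = toeplitz a f i.
Proof.
move=> ak; pose G m := pi (iter (i - m) alpha (a m)) (f (i - m)%N).
transitivity (\sum_(m < k.+1 | (m <= i)%N) G m).
  rewrite /sc_poly bop_sum l2_sum [RHS]big_mkcond; apply: eq_bigr => m _.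
  rewrite -[LHS]/(bop_exp (shift H) m (regular_fun (a m) f) i) shift_expE.
  by case: leqP => // _; rewrite regular_funE.
transitivity (\sum_(m < i.+1) G m); last first.
  rewrite /toeplitz (reindex_inj rev_ord_inj); apply: eq_bigr => m _ /=.
  by rewrite /G subSS subKn// -ltnS.
rewrite (big_ord_widen_cond (k + i).+1 (fun m => m <= i)%N) ?ltnS ?leq_addr//.
rewrite (big_ord_widen_cond (k + i).+1 xpredT) ?ltnS ?leq_addl//.
rewrite big_mkcond [RHS]big_mkcond; apply: eq_bigr => m _ /=; rewrite !ltnS.
case: (leqP m i) => //=; case: (leqP m k) => // km _.
have iter0 j : iter j alpha 0 = 0 by elim: j => //= j ->; rewrite linear0.
rewrite /G ak// -[LHS]/((0 : bop H) (f (i - m)%N)) -(linear0 pi).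
by congr (pi _ _); rewrite iter0.
Qed.

Lemma eq_toeplitz a (y z : nat -> H) i :
  (forall j, (j <= i)%N -> y j = z j) -> toeplitz a y i = toeplitz a z i.
Proof. by move=> yz; apply: eq_bigr => j _; rewrite yz// -ltnS. Qed.

End regular_pair.

(** * Truncated Toeplitz operators *)

Section toeplitz_bound.
Variables (R : realType) (C : cstarType R) (alpha : unitalStarHom C C).
Variables (n : nat) (a : 'I_n -> 'I_n -> nat -> C).

(** The truncation to M coordinates of the operator matrix of the polynomials
    a s t has norm at most B. *)
Definition toeplitz_le (H : hilbertType R) (pi : unitalStarRep C H) (B : R) M :=
  forall y : 'I_n -> nat -> H,
    \sum_s \sum_(i < M) rnorm (\sum_t toeplitz alpha pi (a s t) (y t) i) ^+ 2
    <= B ^+ 2 * \sum_t \sum_(j < M) rnorm (y t j) ^+ 2.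

Definition truncation (H : hilbertType R) M (y : nat -> H) k : H :=
  if (k < M)%N then y k else 0.

Lemma truncation_partial (H : hilbertType R) M (y : nat -> H) N :
  \sum_(k < N) rnorm (truncation M y k) ^+ 2 <= \sum_(k < M) rnorm (y k) ^+ 2.
Proof.
rewrite (big_ord_widen (N + M) (fun k => rnorm (y k) ^+ 2)) ?leq_addl//.
rewrite (big_ord_widen (N + M) (fun k => rnorm (truncation M y k) ^+ 2));
  last exact: leq_addr.
rewrite big_mkcond [leRHS]big_mkcond; apply: ler_sum => k _ /=.
rewrite /truncation; case: (k < M)%N; case: (k < N)%N => //.
  exact: sqr_ge0.
by rewrite rnorm0 expr0n.
Qed.

Fact truncation_l2 (H : hilbertType R) M (y : nat -> H) :
  l2_pred (truncation M y).
Proof.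
apply/asboolP; exists (\sum_(k < M) rnorm (y k) ^+ 2).
exact: truncation_partial.
Qed.

(** A truncation is a compression of the polynomial at the regular pair: it is
    applied to sequences supported on the first M coordinates, and only the
    first M coordinates of the result are kept. *)
Lemma toeplitz_le_regular (H : hilbertType R) (pi : unitalStarRep C H)
    (B : R) d M :
  0 <= B -> (forall s t m, (d < m)%N -> a s t m = 0) ->
  (op_mxnorm (\matrix_(s, t) sc_poly d (a s t) (regular_pair alpha pi))
     <= B%:E)%E ->
  toeplitz_le pi B M.
Proof.
move=> B0 ad /(op_mxnorm_le _ B0) polyB y.
pose f t : l2_hilbert H := L2 (truncation_l2 M (y t)).
have := polyB f; rewrite -(ler_pXn2r (ltn0Sn 1)) ?nnegrE ?mulr_ge0 ?vnorm_ge0//.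
rewrite exprMn !sqr_vnorm => h.
apply: (@le_trans _ _ (B ^+ 2 * \sum_t rnorm (f t) ^+ 2)); last first.
  rewrite ler_wpM2l ?sqr_ge0//; apply: ler_sum => t _.
  by apply: l2_norm_le => N; exact: truncation_partial.
apply: le_trans h; apply: ler_sum => s _; apply: le_trans (l2_partial _ M).
apply: ler_sum => i _; rewrite le_eqVlt; apply/orP; left; apply/eqP.
congr (rnorm _ ^+ 2).
rewrite /mxapp l2_sum; apply: eq_bigr => t _.
rewrite mxE sc_poly_regular; last exact: ad.
by apply: eq_toeplitz => j ji; rewrite /= /truncation (leq_ltn_trans ji).
Qed.

Variable M : nat.

(** The truncation before a representation is applied. It is a square matrix
    over C, whose index stands for a pair formed of an index of the matrix of
    polynomials and a coordinate. *)
Definition toeplitz_mx : 'M[C]_#|{: 'I_n * 'I_M}| :=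
  \matrix_(p < #|{: 'I_n * 'I_M}|, q < #|{: 'I_n * 'I_M}|)
    if ((enum_val q).2 <= (enum_val p).2)%N
    then iter (enum_val q).2 alpha
           (a (enum_val p).1 (enum_val q).1 ((enum_val p).2 - (enum_val q).2))
    else 0.

Lemma sum_pair_enum (F : 'I_n * 'I_M -> R) :
  \sum_(p < #|{: 'I_n * 'I_M}|) F (enum_val p) = \sum_s \sum_i F (s, i).
Proof.
rewrite -(big_enum_val (A := {: 'I_n * 'I_M})) pair_bigA.
by apply: eq_bigr => -[].
Qed.

Lemma toeplitz_mxE (H : hilbertType R) (pi : unitalStarRep C H)
    (y : 'I_n -> nat -> H) p :
  mxapp (map_mx pi toeplitz_mx) (fun q => y (enum_val q).1 (enum_val q).2) p
  = \sum_t toeplitz alpha pi (a (enum_val p).1 t) (y t) (enum_val p).2.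
Proof.
rewrite /mxapp; case E : (enum_val p) => [s i] /=.
pose G (q : 'I_n * 'I_M) := if (q.2 <= i)%N
  then pi (iter q.2 alpha (a s q.1 (i - q.2))) (y q.1 q.2) else 0.
transitivity (\sum_(q < #|{: 'I_n * 'I_M}|) G (enum_val q)).
  apply: eq_bigr => q _; rewrite !mxE E /G /=.
  by case: leqP => // _; rewrite linear0.
rewrite -(big_enum_val (A := {: 'I_n * 'I_M})).
rewrite (eq_bigr (fun q => G (q.1, q.2))) => [|[]//].
rewrite -(pair_bigA _ (fun t j => G (t, j)))/=.
apply: eq_bigr => t _; rewrite /G/= -big_mkcond/= /toeplitz.
pose T j := pi (iter j alpha (a s t (i - j)%N)) (y t j).
by rewrite (big_ord_widen M T).
Qed.

Lemma op_mxnorm_toeplitz (H : hilbertType R) (pi : unitalStarRep C H) (B : R) :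
  0 <= B ->
  (op_mxnorm (map_mx pi toeplitz_mx) <= B%:E)%E <-> toeplitz_le pi B M.
Proof.
move=> B0; have sqP (y : 'I_n -> nat -> H) :
    let x (q : 'I_#|{: 'I_n * 'I_M}|) := y (enum_val q).1 (enum_val q).2 in
    (vnorm (mxapp (map_mx pi toeplitz_mx) x) <= B * vnorm x) =
    (\sum_s \sum_(i < M) rnorm (\sum_t toeplitz alpha pi (a s t) (y t) i) ^+ 2
    <= B ^+ 2 * \sum_t \sum_(j < M) rnorm (y t j) ^+ 2).
  move=> x; rewrite -(ler_pXn2r (ltn0Sn 1)) ?nnegrE ?mulr_ge0 ?vnorm_ge0//.
  rewrite exprMn !sqr_vnorm; congr (_ <= _ * _).
    under eq_bigr do rewrite toeplitz_mxE.
    exact: (sum_pair_enum (fun p =>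
      rnorm (\sum_t toeplitz alpha pi (a p.1 t) (y t) p.2) ^+ 2)).
  exact: (sum_pair_enum (fun q => rnorm (y q.1 q.2) ^+ 2)).
split=> [/(op_mxnorm_le _ B0) TB y|TB]; first by rewrite -sqP.
apply/(op_mxnorm_le _ B0) => x.
pose y t j : H := if insub j is Some j' then x (enum_rank (t, j')) else 0.
have -> : x = fun q : 'I_#|{: 'I_n * 'I_M}| => y (enum_val q).1 (enum_val q).2.
  apply/funext => q; rewrite /y valK -[LHS](congr1 x (enum_valK q)).
  by case: (enum_val q).
by rewrite sqP; exact: TB.
Qed.

End toeplitz_bound.

Section boundary.
Variables (R : realType) (C : cstarType R) (A : set C).
Hypothesis opA : unital_operator_algebra A.
Variable J : closedIdeal C.
Variable alpha : unitalStarHom C C.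
Hypothesis alphaA : alpha @` A `<=` A.
Hypothesis alphaJ : alpha @` (J : set C) `<=` (J : set C).

Lemma opalg0 : A 0.
Proof.
by rewrite -(scale0r (cone : C)); apply: (opalgZ opA); exact: opalg1 opA.
Qed.

Lemma iter_alphaA k c : A c -> A (iter k alpha c).
Proof.
by move=> Ac; elim: k => //= k IH; apply: alphaA; exists (iter k alpha c).
Qed.

Lemma qproj_iter k c :
  qproj J (iter k alpha c) = iter k (quot_endo alphaJ) (qproj J c).
Proof. by elim: k => //= k <-; rewrite quot_endoE. Qed.

(** The norms of toeplitz_mx in C and in C/J agree, its entries being in A. *)
Lemma toeplitz_le_boundary n (a : 'I_n -> 'I_n -> nat -> C) (B : R) M :
  boundary_ideal A J -> 0 <= B -> (forall s t m, A (a s t m)) ->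
  (forall (H : hilbertType R) (sigma : unitalStarRep (cquot J) H),
    toeplitz_le (quot_endo alphaJ)
      (fun s t m => qproj J (a s t m)) sigma B M) ->
  forall (H : hilbertType R) (pi : unitalStarRep C H),
    toeplitz_le alpha a pi B M.
Proof.
move=> bJ B0 Aa sigmaB H pi; apply/(op_mxnorm_toeplitz _ _ _ _ B0).
have ATa p q : A (toeplitz_mx alpha a M p q).
  rewrite mxE; case: ifP => _; last exact: opalg0.
  exact: iter_alphaA.
apply: (@le_trans _ _ (cstar_mxnorm (toeplitz_mx alpha a M))).
  by apply: ereal_sup_ubound; exists H, pi.
rewrite -(bJ _ _ ATa); apply: ub_ereal_sup => _ [H' [sigma ->]].
have -> : map_mx (qproj J) (toeplitz_mx alpha a M) =
    toeplitz_mx (quot_endo alphaJ) (fun s t m => qproj J (a s t m)) M.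
  apply/matrixP => p q; rewrite !mxE; case: ifP => _; last exact: linear0.
  exact: qproj_iter.
exact/(op_mxnorm_toeplitz _ _ _ _ B0).
Qed.

End boundary.

(** * The Wold decomposition and the norm of a polynomial *)

Section wold.
Variables (R : realType) (H : hilbertType R) (K : bop H).
Hypothesis isoK : forall x, `|K x| = `|x|.

(** Iterating range_decomposition gives x = K^i (X i) + sum_{l<i} K^l (u l), an
    orthogonal decomposition by sqr_rnorm_wold_sum. *)
Lemma wold_vectors (x : H) : exists X u : nat -> H,
  [/\ X 0%N = x, forall j, X j = K (X j.+1) + u j &
      forall j z, inner (u j) (K z) = 0].
Proof.
have /choice[g gP] := range_decomposition isoK.
exists (fun j => iter j g x), (fun j => iter j g x - K (iter j.+1 g x)).
split; [by []|by move=> j; rewrite addrC subrK|by move=> j z; exact: gP].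
Qed.

Lemma sqr_rnorm_wold (w u : H) : (forall z, inner u (K z) = 0) ->
  rnorm (K w + u) ^+ 2 = rnorm w ^+ 2 + rnorm u ^+ 2.
Proof.
move=> uK; rewrite sqr_rnormD (rnorm_iso isoK) (innerC u) uK conjC0 /=.
by rewrite mulr0 addr0.
Qed.

Lemma bop_expSr i x : bop_exp K i.+1 x = bop_exp K i (K x).
Proof. by elim: i => // i IH; rewrite -[LHS]/(K (bop_exp K i.+1 x)) IH. Qed.

Lemma sqr_rnorm_wold_sum i (w : H) (z : nat -> H) :
  (forall l y, inner (z l) (K y) = 0) ->
  rnorm (bop_exp K i w + \sum_(l < i) bop_exp K l (z l)) ^+ 2
  = rnorm w ^+ 2 + \sum_(l < i) rnorm (z l) ^+ 2.
Proof.
move=> zK; elim: i w => [|i IH] w; first by rewrite !big_ord0 !addr0.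
rewrite bop_expSr !big_ord_recr/= [X in _ + X]addrC addrA -linearD IH.
by rewrite sqr_rnorm_wold// -addrA [rnorm (z i) ^+ 2 + _]addrC.
Qed.

End wold.

Lemma archimedean_le (R : realType) (P Q D : R) :
  (forall M : nat, M%:R * P <= M%:R * Q + D) -> P <= Q.
Proof.
move=> h; rewrite leNgt; apply/negP => QP.
have PQ : 0 < P - Q by rewrite subr_gt0.
have := h (Num.truncn (D / (P - Q))).+1.
have := truncnS_gt (D / (P - Q)); rewrite ltr_pdivrMr//.
by set m := _%:R; lra.
Qed.

Section wold_estimate.
Variables (R : realType) (C : cstarType R) (alpha : unitalStarHom C C).
Variable p : covariantPair alpha.
Notation K := (cov_iso p).
Notation pi := (cov_rep p).

Lemma cov_commE c x : pi c (K x) = K (pi (alpha c) x).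
Proof. by have := congr1 (fun T : bop _ => T x) (cov_comm p c). Qed.

(** The orthogonal complement of the range of K reduces pi, since
    pi(c)^* K = K pi(alpha(c^* )). *)
Lemma toeplitz_orth a u s z : (forall j y, inner (u j) (K y) = 0) ->
  inner (toeplitz alpha pi a u s) (K z) = 0.
Proof.
move=> uK; rewrite /toeplitz; elim/big_ind : _ => [|x y x0 y0|j _].
- exact: inner0l.
- by rewrite innerDl x0 y0 addr0.
- by rewrite star_repS cov_commE uK.
Qed.

Lemma toeplitz_step a X u i : (forall j, X j = K (X j.+1) + u j) ->
  toeplitz alpha pi a X i =
  K (toeplitz alpha pi a X i.+1 - pi (a i.+1) (X 0%N))
  + toeplitz alpha pi a u i.
Proof.
move=> Xu; have -> : toeplitz alpha pi a X i.+1 - pi (a i.+1) (X 0%N) =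
    \sum_(j < i.+1) pi (iter j.+1 alpha (a (i - j)%N)) (X j.+1).
  by rewrite /toeplitz big_ord_recl/= addrC addKr.
rewrite linear_sum -big_split; apply: eq_bigr => j _ /=.
by rewrite (Xu j) linearD/= cov_commE.
Qed.

(** The left-hand side is the value at x = X 0 of the part of degree at most i
    of the polynomial; the right-hand side is its Wold decomposition. *)
Lemma toeplitz_wold (a : nat -> C) X u i : (forall j, X j = K (X j.+1) + u j) ->
  \sum_(m < i.+1) bop_exp K m (pi (a m) (X 0%N)) =
  bop_exp K i (toeplitz alpha pi a X i)
  + \sum_(l < i) bop_exp K l (toeplitz alpha pi a u l).
Proof.
move=> Xu; elim: i => [|i IH].
  by rewrite big_ord1 big_ord0 addr0 /toeplitz big_ord1 subn0.
rewrite big_ord_recr IH [in RHS]big_ord_recr/= (toeplitz_step _ _ Xu) linearD/=.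
rewrite -bop_expSr linearB/=.
rewrite [LHS]addrAC [X in X + _]addrAC subrK -addrA; congr (_ + _).
exact: addrC.
Qed.

Lemma sc_polyE d (a : nat -> C) x :
  sc_poly d a p x = \sum_(m < d.+1) bop_exp K m (pi (a m) x).
Proof. by rewrite /sc_poly bop_sum. Qed.

Lemma sc_poly_widen d (a : nat -> C) x i : (forall m, (d < m)%N -> a m = 0) ->
  (d <= i)%N -> sc_poly d a p x = \sum_(m < i.+1) bop_exp K m (pi (a m) x).
Proof.
move=> ad di; rewrite sc_polyE.
rewrite (big_ord_widen i.+1 (fun m => bop_exp K m (pi (a m) x)))//.
rewrite big_mkcond; apply: eq_bigr => m _; rewrite ltnS.
by case: leqP => // /ad ->; rewrite linear0 bop0 linear0.
Qed.

(** Put P = |y|^2 for the image y of x, Q = |x|^2, and let Y i and F i be the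
    squared norms of the i-th remainders of x and of y in their Wold
    decompositions. The bound for the vectors u gives P <= F i + B^2 (Q - Y i)
    for i >= d, and the bound for the vectors X gives
    sum_{i<N} F i <= B^2 sum_{i<N} Y i. Adding up over i < d + M yields
    M P <= (d + M) B^2 Q, whence P <= B^2 Q as M grows. *)
Lemma wold_estimate n d (a : 'I_n -> 'I_n -> nat -> C) (B : R) : 0 <= B ->
  (forall s t m, (d < m)%N -> a s t m = 0) ->
  (forall M, toeplitz_le alpha a pi B M) ->
  (op_mxnorm (\matrix_(s, t) sc_poly d (a s t) p) <= B%:E)%E.
Proof.
move=> B0 ad TB; apply/(op_mxnorm_le _ B0) => x.
have /choice[X /choice[u Xu]] : forall t, exists X u : nat -> cov_space p,
    [/\ X 0%N = x t, forall j, X j = K (X j.+1) + u j &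
      forall j z, inner (u j) (K z) = 0].
  by move=> t; exact: wold_vectors (@cov_isoP _ _ _ p) (x t).
set y := mxapp _ x.
pose W i s := \sum_t toeplitz alpha pi (a s t) (X t) i.
pose Z l s := \sum_t toeplitz alpha pi (a s t) (u t) l.
have yE s i : (d <= i)%N ->
    rnorm (y s) ^+ 2 = rnorm (W i s) ^+ 2 + \sum_(l < i) rnorm (Z l s) ^+ 2.
  move=> di; have isoK := @cov_isoP _ _ _ p.
  rewrite -(@sqr_rnorm_wold_sum _ _ _ isoK i (W i s) (Z^~ s)); last first.
    move=> l z; rewrite /Z; elim/big_ind : _ => [|v w v0 w0|t _].
    - exact: inner0l.
    - by rewrite innerDl v0 w0 addr0.
    - by apply: toeplitz_orth => j z'; have [_ _ ->] := Xu t.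
  have lin m (v : 'I_n -> cov_space p) :
      bop_exp K m (\sum_t v t) = \sum_t bop_exp K m (v t) by exact: linear_sum.
  congr (rnorm _ ^+ 2); rewrite /y /mxapp {1}/W lin.
  have -> : \sum_(l < i) bop_exp K l (Z l s) = \sum_t \sum_(l < i)
      bop_exp K l (toeplitz alpha pi (a s t) (u t) l).
    by rewrite exchange_big; apply: eq_bigr => l _; rewrite /Z lin.
  rewrite -big_split; apply: eq_bigr => t _; rewrite mxE.
  have [X0 Xt _] := Xu t; rewrite (sc_poly_widen _ (ad s t) di) -X0.
  exact: toeplitz_wold.
pose Q := \sum_t rnorm (x t) ^+ 2; pose Y i := \sum_t rnorm (X t i) ^+ 2.
have uE i : \sum_t \sum_(l < i) rnorm (u t l) ^+ 2 = Q - Y i.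
  rewrite /Q /Y -sumrB; apply: eq_bigr => t _; have [X0 Xt ut] := Xu t.
  rewrite -X0; elim: i => [|i IH]; first by rewrite big_ord0 subrr.
  rewrite big_ord_recr/= IH (Xt i) (sqr_rnorm_wold (@cov_isoP _ _ _ p))//.
  by rewrite opprD addrA subrK.
pose F i := \sum_s rnorm (W i s) ^+ 2.
have F0 i : 0 <= F i by apply: sumr_ge0 => s _; exact: sqr_ge0.
have YQ i : Y i <= Q.
  rewrite -subr_ge0 -uE; apply: sumr_ge0 => t _; apply: sumr_ge0 => l _.
  exact: sqr_ge0.
pose P := \sum_s rnorm (y s) ^+ 2.
have PF i : (d <= i)%N -> P <= F i + B ^+ 2 * (Q - Y i).
  move=> di; rewrite -uE; apply: le_trans (lerD (lexx _) (TB i u)).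
  rewrite /P /F -big_split le_eqVlt; apply/orP; left; apply/eqP.
  by apply: eq_bigr => s _; rewrite (yE s i di).
have FY N : \sum_(i < N) F i <= B ^+ 2 * \sum_(i < N) Y i.
  by rewrite exchange_big [in leRHS]exchange_big; exact: TB.
have sumP M : M%:R * P <= \sum_(i < d + M) (F i + B ^+ 2 * (Q - Y i)).
  elim: M => [|M IH].
    rewrite mul0r addn0; apply: sumr_ge0 => i _.
    by rewrite addr_ge0// mulr_ge0 ?sqr_ge0 ?subr_ge0.
  by rewrite addnS big_ord_recr/= -natr1 mulrDl mul1r lerD// PF// leq_addr.
rewrite -(ler_pXn2r (ltn0Sn 1)) ?nnegrE ?mulr_ge0 ?vnorm_ge0//.
rewrite exprMn !sqr_vnorm -/P -/Q.
apply: (@archimedean_le _ _ _ (d%:R * (B ^+ 2 * Q))) => M.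
apply: le_trans (sumP M) _; rewrite big_split/= -mulr_sumr sumrB.
rewrite sumr_const card_ord -[Q *+ _]mulr_natl natrD.
have := FY (d + M)%N; set f := \sum_(i < _) F i; set g := \sum_(i < _) Y i.
by set b := B ^+ 2; lra.
Qed.

End wold_estimate.

(** * Density of the polynomials *)

Section closed_subalgebras.
Variables (R : realType) (I : Type) (H : I -> hilbertType R).
Implicit Types (F G : opfam H) (S : opfam H -> Prop).

Lemma fam_closureP S F : fam_closure S F <-> forall e : R, 0 < e ->
  exists2 G, S G & forall i x, rnorm (F i x - G i x) <= e * rnorm x.
Proof.
split=> SF e e0; have [G SG FG] := SF e e0; exists G => //.
  by move=> i x; have /(fam_norm_le _ (ltW e0)) := FG; exact.
by apply/fam_norm_le => [|i x]; [exact: ltW|exact: FG].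
Qed.

Lemma sub_fam_closure S F : S F -> fam_closure S F.
Proof.
move=> SF; apply/fam_closureP => e e0; exists F => // i x.
by rewrite subrr rnorm0 mulr_ge0 ?rnorm_ge0// ltW.
Qed.

Lemma closed_subalgebra_gen (X : opfam H -> Prop) :
  closed_subalgebra (gen_closed_subalgebra X).
Proof.
split.
- move=> F XF S cS XS; apply: (Defs.subalg_closed cS) => e /XF[G XG FG].
  by exists G => //; exact: XG.
- by move=> S cS _; exact: subalg0.
- by move=> F G XF XG S cS XS; apply: (subalgD cS); [exact: XF|exact: XG].
- by move=> k F XF S cS XS; apply: (subalgZ cS); exact: XF.
- by move=> F G XF XG S cS XS; apply: (subalgM cS); [exact: XF|exact: XG].
Qed.

Definition bounded_family F :=
  exists2 B : R, 0 <= B & forall i x, rnorm (F i x) <= B * rnorm x.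

(** Boundedness is what makes multiplication continuous. *)
Lemma closed_subalgebra_closure S :
  S (fun=> 0) ->
  (forall F G, S F -> S G -> S (fun i => F i + G i)) ->
  (forall (k : R[i]) F, S F -> S (fun i => k *: F i)) ->
  (forall F G, S F -> S G -> S (fun i => bop_comp (F i) (G i))) ->
  (forall F, S F -> bounded_family F) ->
  closed_subalgebra (fam_closure S).
Proof.
move=> S0 SD SZ SM SB; split.
- move=> F /fam_closureP SF; apply/fam_closureP => e e0.
  have e20 : 0 < e / 2 by rewrite divr_gt0.
  have [G /fam_closureP/(_ _ e20)[G' SG' GG'] FG] := SF _ e20.
  exists G' => // i x; rewrite -(subrKA (G i x)) (le_trans (rnormD _ _))//.
  by have := FG i x; have := GG' i x; lra.
- exact: sub_fam_closure.
- move=> F G /fam_closureP SF /fam_closureP SG; apply/fam_closureP => e e0.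
  have e20 : 0 < e / 2 by rewrite divr_gt0.
  have [F' SF' FF'] := SF _ e20; have [G' SG' GG'] := SG _ e20.
  exists (fun i => F' i + G' i); first exact: SD.
  move=> i x; rewrite !bopD opprD addrACA (le_trans (rnormD _ _))//.
  by have := FF' i x; have := GG' i x; lra.
- move=> k F /fam_closureP SF; apply/fam_closureP => e e0.
  pose r := complex.Re `|k|.
  have r0 : 0 <= r by rewrite -ler0c RRe_real// normr_real.
  have r1 : 0 < r + 1 by rewrite ltr_wpDl.
  have er0 : 0 < e / (r + 1) by rewrite divr_gt0.
  have [F' SF' FF'] := SF _ er0.
  exists (fun i => k *: F' i); first exact: SZ.
  move=> i x; rewrite !bopZ -scalerBr rnormZ -/r.
  apply: le_trans (ler_wpM2l r0 (FF' i x)) _; rewrite mulrA.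
  rewrite ler_wpM2r ?rnorm_ge0// mulrCA ler_piMr ?(ltW e0)//.
  by rewrite ler_pdivrMr// mul1r lerDl.
move=> F G /fam_closureP SF /fam_closureP SG; apply/fam_closureP => e e0.
have [F1 /SB[B B0 F1B] FF1] := SF _ ltr01.
have FB i x : rnorm (F i x) <= (B + 1) * rnorm x.
  rewrite -(subrK (F1 i x) (F i x)) (le_trans (rnormD _ _))//.
  by have := FF1 i x; have := F1B i x; lra.
have B1 : 0 < B + 1 by rewrite ltr_wpDl.
have d0 : 0 < e / 2 / (B + 1) by rewrite !divr_gt0.
have [G' SG' GG'] := SG _ d0; have [D D0 G'D] := SB _ SG'.
have D1 : 0 < D + 1 by rewrite ltr_wpDl.
have c0 : 0 < e / 2 / (D + 1) by rewrite !divr_gt0.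
have [F' SF' FF'] := SF _ c0.
exists (fun i => bop_comp (F' i) (G' i)); first exact: SM.
move=> i x; rewrite /= -(subrKA (F i (G' i x))) -linearB.
apply: le_trans (rnormD _ _) _.
have -> : e * rnorm x = e / 2 * rnorm x + e / 2 * rnorm x by lra.
apply: lerD.
  apply: le_trans (FB _ _) _.
  apply: le_trans (ler_wpM2l (ltW B1) (GG' i x)) _.
  by rewrite mulrA [_ * (e / 2 / _)]mulrC divfK// gt_eqF.
apply: le_trans (FF' _ _) _.
apply: le_trans (ler_wpM2l (ltW c0) (G'D i x)) _.
rewrite mulrA ler_wpM2r ?rnorm_ge0// mulrAC ler_pdivrMr//.
by rewrite ler_wpM2l ?divr_ge0 ?(ltW e0)// lerDl.
Qed.

End closed_subalgebras.

Section polynomials.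
Variables (R : realType) (C : cstarType R) (alpha : unitalStarHom C C).
Variable A : set C.
Hypothesis opA : unital_operator_algebra A.
Hypothesis alphaA : alpha @` A `<=` A.

Definition poly_family (G : covfam alpha) := exists k c,
  [/\ forall m, A (c m), forall m, (k < m)%N -> c m = 0 &
      forall p x, G p x = sc_poly k c p x].

Lemma poly_family_mono k a : A a ->
  poly_family (fun p => bop_comp (bop_exp (cov_iso p) k) (cov_rep p a)).
Proof.
move=> Aa; exists k, (fun m => if m == k then a else 0); split.
- by move=> m; case: eqP => // _; exact: opalg0.
- by move=> m; case: eqP => // ->; rewrite ltnn.
move=> p x; rewrite sc_polyE (bigD1 ord_max)//= eqxx big1 ?addr0// => m mk.
by rewrite ifN; [rewrite linear0 bop0 linear0|exact: mk].
Qed.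

Lemma poly_family0 : poly_family (fun=> 0).
Proof.
exists 0%N, (fun=> 0); split=> [_|//|p x]; first exact: opalg0.
by rewrite sc_polyE big1// => m _; rewrite linear0 bop0 linear0.
Qed.

Lemma poly_familyD F G : poly_family F -> poly_family G ->
  poly_family (fun p => F p + G p).
Proof.
move=> [k [c [Ac ck Fc]]] [l [d [Ad dl Gd]]].
exists (k + l)%N, (fun m => c m + d m); split=> [m|m klm|p x].
- exact: (opalgD opA).
- by rewrite ck ?dl ?addr0// (leq_ltn_trans _ klm)// ?leq_addr// leq_addl.
rewrite bopD Fc Gd [RHS]sc_polyE (sc_poly_widen _ ck (leq_addr l k)).
rewrite (sc_poly_widen _ dl (leq_addl k l)) -big_split; apply: eq_bigr => m _.
by rewrite linearD bopD linearD.
Qed.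

Lemma poly_familyZ (z : R[i]) F : poly_family F ->
  poly_family (fun p => z *: F p).
Proof.
move=> [k [c [Ac ck Fc]]]; exists k, (fun m => z *: c m); split=> [m|m km|p x].
- exact: (opalgZ opA).
- by rewrite ck// scaler0.
rewrite bopZ Fc !sc_polyE scaler_sumr; apply: eq_bigr => m _.
by rewrite linearZ bopZ linearZ.
Qed.

Lemma poly_family_sum n (F : 'I_n -> covfam alpha) :
  (forall i, poly_family (F i)) -> poly_family (fun p => \sum_i F i p).
Proof.
elim: n F => [|n IH] F PF.
  have [k [c [Ac ck Fc]]] := poly_family0; exists k, c; split=> // p x.
  by rewrite big_ord0 Fc.
have [k [c [Ac ck Fc]]] := poly_familyD
  (IH _ (fun i => PF (widen_ord (leqnSn n) i))) (PF ord_max).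
by exists k, c; split=> // p x; rewrite big_ord_recr Fc.
Qed.

Lemma poly_family_ext (F G : covfam alpha) : (forall p x, F p x = G p x) ->
  poly_family F -> poly_family G.
Proof.
by move=> FG [k [c [Ac ck Fc]]]; exists k, c; split=> // p x; rewrite -FG.
Qed.

Lemma cov_comm_exp (p : covariantPair alpha) k a x :
  cov_rep p a (bop_exp (cov_iso p) k x)
  = bop_exp (cov_iso p) k (cov_rep p (iter k alpha a) x).
Proof.
elim: k a => // k IH a.
rewrite -[LHS]/(cov_rep p a (cov_iso p (bop_exp (cov_iso p) k x))) cov_commE IH.
by rewrite -iterSr.
Qed.

Lemma bop_expD (H : hilbertType R) (K : bop H) k l x :
  bop_exp K (k + l) x = bop_exp K k (bop_exp K l x).
Proof.
by elim: k => // k IH; rewrite addSn /= /bop_exp/= in IH *; rewrite IH.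
Qed.

(** Products of monomials are monomials by covariance,
    K^i pi(c) K^j pi(d) = K^(i+j) pi(alpha^j(c) d), with coefficient in A since
    alpha leaves A invariant. *)
Lemma poly_familyM F G : poly_family F -> poly_family G ->
  poly_family (fun p => bop_comp (F p) (G p)).
Proof.
move=> [k [c [Ac ck Fc]]] [l [d [Ad dl Gd]]].
pose T i j p := bop_comp (bop_exp (cov_iso p) (i + j))
  (cov_rep (alpha := alpha) p (iter j alpha (c i) ** d j)).
apply: (@poly_family_ext (fun p => \sum_(i < k.+1) \sum_(j < l.+1) T i j p)).
  move=> p x; rewrite bop_sum /= Fc Gd !sc_polyE; apply: eq_bigr => i _.
  rewrite bop_sum !linear_sum; apply: eq_bigr => j _.
  by rewrite /= bop_expD cov_comm_exp star_repM.
apply: poly_family_sum => i; apply: poly_family_sum => j.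
apply: poly_family_mono; apply: (opalgM opA) => //.
exact: iter_alphaA.
Qed.

Lemma poly_family_bounded F : poly_family F -> bounded_family F.
Proof.
move=> [k [c [Ac ck Fc]]]; exists (\sum_(m < k.+1) 2 * rnorm (c m)).
  by apply: sumr_ge0 => m _; rewrite mulr_ge0 ?rnorm_ge0.
move=> p x; rewrite Fc sc_polyE mulr_suml.
elim/big_ind2 : _ => [|a b v w ab vw|m _]; first by rewrite rnorm0.
  by rewrite (le_trans (rnormD _ _))// lerD.
have expK (y : cov_space p) n : rnorm (bop_exp (cov_iso p) n y) = rnorm y.
  elim: n => // n IH; rewrite -[RHS]IH; exact: (rnorm_iso (@cov_isoP _ _ _ p)).
by rewrite expK; exact: star_rep_bounded.
Qed.

Definition sc_generator (G : covfam alpha) :=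
  (exists2 a, A a & G = sc_coef a) \/ G = @sc_iso R C alpha.

Lemma gen_poly_closure F :
  gen_closed_subalgebra sc_generator F -> fam_closure poly_family F.
Proof.
apply; last move=> G.
  apply: closed_subalgebra_closure.
  - exact: poly_family0.
  - exact: poly_familyD.
  - exact: poly_familyZ.
  - exact: poly_familyM.
  - exact: poly_family_bounded.
move=> genG; apply: sub_fam_closure; case: genG => [[a Aa ->]|->].
  by apply: poly_family_ext (poly_family_mono 0 Aa) => p x.
apply: poly_family_ext (poly_family_mono 1 (opalg1 opA)) => p x.
by rewrite /= star_rep1.
Qed.

(** Limits of A-polynomials are limits of polynomials, so the closed algebra
    generated by A and the isometry lies in the semicrossed product. *)
Lemma relative_scE F :
  relative_semicrossed_product alpha A F <->
  gen_closed_subalgebra sc_generator F.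
Proof.
split=> [[]//|genF]; split=> //.
have /fam_closureP pF := gen_poly_closure genF.
apply/fam_closureP => e /pF[G [k [c [_ _ Gc]]] FG].
by exists (sc_poly k c) => [|p x]; [exists k, c|rewrite -Gc].
Qed.

End polynomials.

(** * Restriction to the covariant pairs of the quotient *)

Section quotient_semicrossed.
Variables (R : realType) (C : cstarType R) (A : set C).
Hypothesis opA : unital_operator_algebra A.
Variable J : closedIdeal C.
Hypothesis bJ : boundary_ideal A J.
Variable alpha : unitalStarHom C C.
Hypothesis alphaA : alpha @` A `<=` A.
Hypothesis alphaJ : alpha @` (J : set C) `<=` (J : set C).

Notation beta := (quot_endo alphaJ).

Section pullback.
Variable q : covariantPair beta.

Fact pullback_comm c :
  bop_comp (rep_comp (qproj J) (cov_rep q) c) (cov_iso q)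
  = bop_comp (cov_iso q) (rep_comp (qproj J) (cov_rep q) (alpha c)).
Proof.
rewrite -[RHS]/(bop_comp (cov_iso q) (cov_rep q (qproj J (alpha c)))).
by rewrite -(quot_endoE alphaJ); exact: cov_comm.
Qed.

Definition pullback : covariantPair alpha :=
  CovariantPair (@cov_isoP _ _ _ q) pullback_comm.

End pullback.

Definition restrict (F : covfam alpha) : covfam beta := fun q => F (pullback q).

(** A representation of C forces one of C/J to exist, since otherwise the norm
    over the empty set of representations of C/J would be -oo, contrary to J
    being a boundary ideal. *)
Lemma quotient_pair (p : covariantPair alpha) :
  inhabited (covariantPair beta).
Proof.
pose M0 : 'M[C]_0 := 0.
have : (-oo < cstar_mxnorm (map_mx (qproj J) M0))%E.
  rewrite bJ => [|[]//]; apply: (@lt_le_trans _ _ 0%E); first exact: ltNy0.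
  apply: le_trans (op_mxnorm_ge0 (map_mx (cov_rep p) M0)) _.
  by apply: ereal_sup_ubound; exists (cov_space p), (cov_rep p).
move=> /ereal_sup_gt[_ [H [sigma _]] _].
exact: inhabits (regular_pair _ sigma).
Qed.

(** The pairs that vanish on J already attain the norms of matrices of
    A-polynomials: the bound passes from regular pairs of C/J to truncations
    over C/J, then to truncations over C, then to all pairs of C. *)
Lemma op_mxnorm_poly n (k : 'I_n -> 'I_n -> nat) (c : 'I_n -> 'I_n -> nat -> C)
    (r : R) :
  0 <= r -> (forall s t m, A (c s t m)) ->
  (forall s t m, (k s t < m)%N -> c s t m = 0) ->
  (forall q : covariantPair beta,
     op_mxnorm (\matrix_(s, t) sc_poly (k s t) (c s t) (pullback q))
       <= r%:E)%E ->
  forall p : covariantPair alpha,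
    (op_mxnorm (\matrix_(s, t) sc_poly (k s t) (c s t) p) <= r%:E)%E.
Proof.
move=> r0 Ac ck qr p.
(* a common bound for the degrees *)
pose d := (\sum_s \sum_t k s t)%N.
have kd s t : (k s t <= d)%N.
  rewrite /d (bigD1 s)//= (bigD1 t)//= -addnA leq_addr//.
have cd s t m : (d < m)%N -> c s t m = 0.
  by move=> dm; apply: ck; exact: leq_ltn_trans dm.
have polyE (p' : covariantPair alpha) :
    \matrix_(s < n, t < n) sc_poly (k s t) (c s t) p'
    = \matrix_(s < n, t < n) sc_poly d (c s t) p'.
  apply/matrixP => s t; rewrite !mxE; apply: bopP => x.
  by rewrite (sc_poly_widen _ (@ck s t) (kd s t)) sc_polyE.
rewrite polyE; apply: wold_estimate => // M.
apply: (toeplitz_le_boundary opA alphaA (alphaJ := alphaJ)) => // H sigma.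
apply: (toeplitz_le_regular (d := d)) => //.
  by move=> s t m /cd ->; exact: linear0.
by have := qr (regular_pair beta sigma); rewrite polyE.
Qed.

Notation X := (gen_closed_subalgebra (@sc_generator R C alpha A)).

(** Both sides are continuous in M, so by density the entries may be taken to be
    A-polynomials. Only coefficients and degrees of the approximants are
    chosen, these being small objects, unlike families. *)
Lemma fam_mxnorm_restrict n (M : 'I_n -> 'I_n -> covfam alpha) :
  (forall s t, X (M s t)) ->
  fam_mxnorm (fun s t => restrict (M s t)) = fam_mxnorm M.
Proof.
move=> XM; apply/le_anti/andP; split.
  apply/fam_mxnorm_le => q.
  by have /fam_mxnorm_le/(_ (pullback q)) := lexx (fam_mxnorm M).
apply/fam_mxnorm_le => p; have [q0] := quotient_pair p.
have qM q : (op_mxnorm (\matrix_(s, t) M s t (pullback q))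
    <= fam_mxnorm (fun s t => restrict (M s t)))%E.
  by move: q; apply/fam_mxnorm_le.
have N0 := le_trans (op_mxnorm_ge0 _) (qM q0).
case: (fam_mxnorm _) qM N0 => [r| |] qM r0; [|exact: leey|by []].
rewrite lee_fin in r0; apply/lee_addgt0Pr => e e0; rewrite -EFinD.
pose g : R := Num.sqrt n%:R * n%:R.
have g0 : 0 <= g by rewrite mulr_ge0 ?sqrtr_ge0 ?ler0n.
have g1 : 0 < 2 * g + 1 by rewrite ltr_wpDl// mulr_ge0.
pose h := e / (2 * g + 1).
have h0 : 0 < h by rewrite divr_gt0.
have ghe : 2 * (g * h) <= e.
  have : h * (2 * g + 1) = e by rewrite /h divfK// gt_eqF.
  by lra.
have /choice[k /choice[c kc]] : forall s, exists k : 'I_n -> nat,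
    exists c : 'I_n -> nat -> C, forall t,
    [/\ forall m, A (c t m), forall m, (k t < m)%N -> c t m = 0 &
      forall p x, rnorm (M s t p x - sc_poly (k t) (c t) p x) <= h * rnorm x].
  move=> s.
  have /choice[k /choice[c kc]] : forall t, exists k, exists c : nat -> C,
      [/\ forall m, A (c m), forall m, (k < m)%N -> c m = 0 &
        forall p x, rnorm (M s t p x - sc_poly k c p x) <= h * rnorm x].
    move=> t.
    have /fam_closureP/(_ _ h0) := gen_poly_closure opA alphaA (XM s t).
    move=> [G [k [c [Ac ck Gc]]] MG]; exists k, c; split=> // p' x.
    by rewrite -Gc.
  by exists k, c.
have dist (p' : covariantPair alpha) s t x :
    rnorm ((M s t p' - sc_poly (k s t) (c s t) p') x) <= h * rnorm x.
  by have [_ _] := kc s t; exact.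
pose P (p' : covariantPair alpha) :=
  \matrix_(s < n, t < n) sc_poly (k s t) (c s t) p'.
have Pp : (op_mxnorm (P p) <= (r + g * h)%:E)%E.
  apply: op_mxnorm_poly => [|s t m|s t m|q].
  - by rewrite addr_ge0// mulr_ge0// ltW.
  - by have [] := kc s t.
  - by have [_ + _] := kc s t; exact.
  have -> : \matrix_(s < n, t < n) sc_poly (k s t) (c s t) (pullback q)
      = \matrix_(s < n, t < n) M s t (pullback q)
        + \matrix_(s < n, t < n)
            (sc_poly (k s t) (c s t) (pullback q) - M s t (pullback q)).
    by apply/matrixP => s t; rewrite !mxE addrC subrK.
  apply: op_mxnormD => //; first by rewrite mulr_ge0// ltW.
  apply: op_mxnorm_entries => [|s t x]; first exact: ltW.
  by rewrite mxE -rnormN -[X in rnorm X]/((- (_ - _) : bop _) x) opprB.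
have -> : \matrix_(s < n, t < n) M s t p = P p
    + \matrix_(s < n, t < n) (M s t p - sc_poly (k s t) (c s t) p).
  by apply/matrixP => s t; rewrite !mxE addrC subrK.
apply: (@le_trans _ _ (r + g * h + g * h)%:E); last by rewrite lee_fin; lra.
apply: op_mxnormD => //.
- by rewrite addr_ge0// mulr_ge0// ltW.
- by rewrite mulr_ge0// ltW.
by apply: op_mxnorm_entries => [|s t x]; [exact: ltW|rewrite mxE].
Qed.

Lemma restrict_bound F (B : R) : 0 <= B -> X F ->
  (forall q x, rnorm (restrict F q x) <= B * rnorm x) ->
  forall p x, rnorm (F p x) <= B * rnorm x.
Proof.
move=> B0 XF qB; apply/fam_norm_le => //.
rewrite /fam_norm -(@fam_mxnorm_restrict 1 (fun _ _ => F))//.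
exact/(fam_norm_le (restrict F) B0).
Qed.

Lemma gen_sub F G : X F -> X G -> X (fun p => F p - G p).
Proof.
move=> XF XG; have cX := closed_subalgebra_gen (@sc_generator R C alpha A).
have XN := Defs.subalgZ cX (-1) XG.
have := Defs.subalgD cX XF XN.
suff -> : (fun p => F p + -1 *: G p) = (fun p => F p - G p) by [].
by apply: functional_extensionality_dep => p; rewrite scaleN1r.
Qed.

Lemma restrict_inj F G : X F -> X G ->
  (forall q, restrict F q = restrict G q) -> F = G.
Proof.
move=> XF XG FG; apply: functional_extensionality_dep => p; apply: bopP => x.
apply/subr0_eq/rnorm_eq0/le_anti; rewrite rnorm_ge0 andbT.
have := @restrict_bound _ 0 (lexx _) (gen_sub XF XG) _ p x.
rewrite mul0r; apply=> q y; have := FG q; rewrite /restrict => ->.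
by rewrite subrr rnorm0 mul0r.
Qed.

(** If the restrictions of F_k tend to G, then the F_k are Cauchy because
    restriction is isometric, and they converge at each pair p. The limit L at
    p is characterized without choosing the families F_k: it lies within e of
    F p for every F whose restriction lies within e of G. *)
Lemma restrict_closed (G : covfam beta) :
  fam_closure (fun G' => exists2 F, X F & restrict F = G') G ->
  exists2 F, X F & restrict F = G.
Proof.
move=> /fam_closureP clG.
have cX := closed_subalgebra_gen (@sc_generator R C alpha A).
pose approx (e : R) F := X F /\
  forall q x, rnorm (G q x - restrict F q x) <= e * rnorm x.
have approx_ex e : 0 < e -> exists F, approx e F.
  by move=> e0; have [_ [F XF <-] FG] := clG e e0; exists F.
have approx_dist e d F F' p x : 0 <= e -> 0 <= d -> approx e F -> approx d F' ->
    rnorm (F p x - F' p x) <= (e + d) * rnorm x.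
  move=> e0 d0 [XF FG] [XF' FG'].
  apply: (@restrict_bound _ _ (addr_ge0 e0 d0) (gen_sub XF XF')) => q y.
  rewrite -[restrict _ q y]/(restrict F q y - restrict F' q y).
  rewrite -(subrKA (G q y)) mulrDl (le_trans (rnormD _ _))// lerD//.
  by rewrite rnormB; exact: FG.
have geo0 k : 0 < 2^-1 ^+ k :> R by exact: geo2_gt0.
have lim_ex p : exists L : bop (cov_space p), forall e F x,
    0 <= e -> approx e F -> rnorm (L x - F p x) <= e * rnorm x.
  have /choice[T Tk] : forall k, exists T : bop (cov_space p),
      exists2 F, approx (2^-1 ^+ k) F & F p = T.
    by move=> k; have [F nF] := approx_ex _ (geo0 k); exists (F p), F.
  have [|L LT] := @bop_geo_limit _ _ T 2.
    move=> k x; have [F nF <-] := Tk k; have [F' nF' <-] := Tk k.+1.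
    apply: le_trans (approx_dist _ _ _ _ _ _ _ _ nF' nF) _; try exact: ltW.
    rewrite ler_wpM2r ?rnorm_ge0// exprS; have := geo0 k; set u := _ ^+ k; lra.
  exists L => e F x e0 nF; apply: (@ler_addgeo _ _ _ (5 * rnorm x)).
    by rewrite mulr_ge0// rnorm_ge0.
  move=> k; have := LT k x; have [F' nF' <-] := Tk k => h.
  have h' := approx_dist _ _ _ _ p x (ltW (geo0 k)) e0 nF' nF.
  rewrite -(subrKA (F' p x)) (le_trans (rnormD _ _))//.
  by move: h h'; set u := _ ^+ k; set v := rnorm x; lra.
pose F p := projT1 (cid (lim_ex p)).
have FP p e F' x : 0 <= e -> approx e F' ->
    rnorm (F p x - F' p x) <= e * rnorm x.
  by move=> e0 nF'; exact: (projT2 (cid (lim_ex p))).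
exists F.
  apply: (Defs.subalg_closed cX); apply/fam_closureP => e e0.
  have [F' nF'] := approx_ex _ e0; exists F'; first by case: nF'.
  by move=> p x; apply: FP => //; exact: ltW.
apply: functional_extensionality_dep => q; apply: bopP => x.
apply/subr0_eq/rnorm_eq0/le_anti; rewrite rnorm_ge0 andbT.
apply/ler_addgt0Pr => e e0; rewrite add0r.
have v1 : 0 < 2 * rnorm x + 1 by rewrite ltr_wpDl// mulr_ge0// rnorm_ge0.
have h0 : 0 < e / (2 * rnorm x + 1) by rewrite divr_gt0.
have [F' nF'] := approx_ex _ h0; have [_ /(_ q x) GF'] := nF'.
have FF' := FP (pullback q) _ _ x (ltW h0) nF'.
rewrite -(subrKA (F' (pullback q) x)) (le_trans (rnormD _ _))//.
rewrite [X in _ + X]rnormB; apply: le_trans (lerD FF' GF') _.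
have : e / (2 * rnorm x + 1) * (2 * rnorm x + 1) = e by rewrite divfK// gt_eqF.
by move: h0; set h := e / _; set v := rnorm x; lra.
Qed.

End quotient_semicrossed.

Theorem proposition2p3 (R : realType) (C : cstarType R) (A : set C)
    (opA : unital_operator_algebra A) (coverA : cstar_cover A)
    (J : closedIdeal C) (silovJ : silov_ideal A J)
    (alpha : unitalStarHom C C) (alphaA : alpha @` A `<=` A)
    (alphaJ : alpha @` (J : set C) `<=` (J : set C)) :
  completely_isometrically_isomorphic
    (relative_semicrossed_product alpha A)
    (relative_semicrossed_product (quot_endo alphaJ) (qproj J @` A)).
Proof.
have [bJ _] := silovJ.
have scE := relative_scE opA alphaA.
exists (@restrict R C J alpha alphaJ); split; [split| | | |] => //.
- move=> F [/fam_closureP scF genF]; split.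
    apply/fam_closureP => e /scF[_ [k [c ->]] Fc].
    pose qc m := qproj J (c m).
    exists (sc_poly k qc); first by exists k, qc.
    by move=> q x; exact: (Fc (pullback q) x).
  move=> S cS genS.
  apply: (genF (fun F' => S (restrict (alphaJ := alphaJ) F'))).
    split.
    + move=> F' /fam_closureP clF'; apply: (Defs.subalg_closed cS).
      apply/fam_closureP => e /clF'[G SG FG].
      exists (restrict (alphaJ := alphaJ) G) => //.
      by move=> q x; exact: (FG (pullback q) x).
    + exact: Defs.subalg0 cS.
    + by move=> F' G; exact: (Defs.subalgD cS).
    + by move=> k F'; exact: (Defs.subalgZ cS).
    + by move=> F' G; exact: (Defs.subalgM cS).
  move=> G [[a Aa ->]|->]; apply: genS; last by right.
  by left; exists (qproj J a) => //; exists a.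
- move=> F G /scE XF /scE XG FG.
  apply: (restrict_inj opA bJ alphaA (alphaJ := alphaJ)) => // q.
  by rewrite FG.
- move=> G [_ genG].
  have cX := closed_subalgebra_gen (@sc_generator R C alpha A).
  have [F XF FG] : exists2 F,
      gen_closed_subalgebra (@sc_generator R C alpha A) F
      & restrict (alphaJ := alphaJ) F = G.
    apply: (genG (fun G' => exists2 F,
      gen_closed_subalgebra (@sc_generator R C alpha A) F
      & restrict (alphaJ := alphaJ) F = G')).
      split.
      + exact: (restrict_closed opA bJ alphaA).
      + by exists (fun=> 0) => //; exact: Defs.subalg0 cX.
      + move=> _ _ [F XF <-] [F' XF' <-]; exists (fun p => F p + F' p) => //.
        exact: Defs.subalgD cX _ _ XF XF'.
      + move=> k _ [F XF <-]; exists (fun p => k *: F p) => //.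
        exact: Defs.subalgZ cX k _ XF.
      + move=> _ _ [F XF <-] [F' XF' <-].
        exists (fun p => bop_comp (F p) (F' p)) => //.
        exact: Defs.subalgM cX _ _ XF XF'.
    move=> _ [[_ [a Aa <-] ->]|->].
      by exists (sc_coef a) => // S cS; apply; left; exists a.
    by exists (@sc_iso R C alpha) => // S cS; apply; right.
  by exists F => //; apply/scE.
move=> n M XM; apply: (fam_mxnorm_restrict opA bJ alphaA) => s t.
exact/scE.
Qed.
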